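(* Every subcubic planar graph with girth at least $8$ is packing $(1,1,2,2)$-colorable.
   Context: Graphs are finite and simple. A graph is subcubic if its maximum degree is at most $3$. The girth is the length of a shortest cycle (infinite if there is no cycle). For a non-decreasing sequence of positive integers $S=(s_1,\dots,s_k)$, a packing $S$-coloring of $G$ is a partition of $V(G)$ into (possibly empty) sets $V_1,\dots,V_k$ such that for each $1\le i\le k$ the distance in $G$ between any two distinct $x,y\in V_i$ is at least $s_i+1$ (vertices in different components are at infinite distance). $G$ is packing $S$-colorable if it has a packing $S$-coloring. *)

(* Defs.v *)
From mathcomp Require Import all_boot all_order all_algebra.
From mathcomp Require Import all_classical all_reals all_analysis.

Set Implicit Arguments.
Unset Strict Implicit.
Unset Printing Implicit Defensive.

Import Order.TTheory GRing.Theory Num.Theory.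
Import numFieldNormedType.Exports.

Local Open Scope classical_set_scope.
Local Open Scope ring_scope.

(* A finite simple graph is a symmetric irreflexive relation [e] on a finite
   type [T] of vertices. Lengths live in [\bar R], so that the infimum over an
   empty set of lengths is [+oo]. *)

Definition degree (T : finType) (e : rel T) (x : T) : nat :=
  #|[pred y | e x y]|.

Definition subcubic (T : finType) (e : rel T) : Prop :=
  (\max_(x : T) degree e x <= 3)%N.

(* [path e x p] is the walk [x :: p], whose number of edges is [size p]. *)
Definition gdist (R : realType) (T : finType) (e : rel T) (x y : T) : \bar R :=
  ereal_inf [set ((size p)%:R)%:E | p in
    [set p : seq T | path e x p /\ last x p = y]].

(* [ucycle e c] alone also holds for [::] and, when [e x y], for [:: x; y]. *)
Definition girth (R : realType) (T : finType) (e : rel T) : \bar R :=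
  ereal_inf [set ((size c)%:R)%:E | c in
    [set c : seq T | ucycle e c /\ (2 < size c)%N]].

(* The parts of the partition are the (possibly empty) fibres of [c]; colours
   are numbered from 0. *)
Definition packing_coloring (R : realType) (T : finType) (e : rel T)
    (S : seq nat) (c : T -> 'I_(size S)) : Prop :=
  forall x y : T, x <> y -> c x = c y ->
    (((nth 0%N S (c x)).+1%:R)%:E <= gdist R e x y)%E.

Definition packing_colorable (R : realType) (T : finType) (e : rel T)
    (S : seq nat) : Prop :=
  exists c : T -> 'I_(size S), packing_coloring R e c.

(* A crossing-free drawing in the plane [R * R]: the edge between [x] and [y]
   is a simple arc, parametrized by [arc x y] from [x] to [y] and by [arc y x]
   in the opposite direction; it meets the vertices and the other edges at most
   in its ends. *)
Record plane_drawing (R : realType) (T : finType) (e : rel T)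
    (pos : T -> R * R) (arc : T -> T -> R -> R * R) : Prop := PlaneDrawing {
  pos_inj : injective pos;
  arc_continuous : forall x y, e x y ->
    {within `[0, 1], continuous (arc x y)};
  arc_inj : forall x y, e x y -> {in `[0, 1]%R &, injective (arc x y)};
  arc_start : forall x y, e x y -> arc x y 0 = pos x;
  arc_end : forall x y, e x y -> arc x y 1 = pos y;
  arc_reverse : forall x y (t : R), e x y -> t \in `[0, 1]%R ->
    arc y x t = arc x y (1 - t);
  arc_avoids_pos : forall x y z (t : R), e x y -> t \in `]0, 1[%R ->
    arc x y t <> pos z;
  arc_disjoint : forall x y x' y' (t t' : R), e x y -> e x' y' ->
    (x', y') <> (x, y) -> (x', y') <> (y, x) ->
    t \in `]0, 1[%R -> t' \in `]0, 1[%R -> arc x y t <> arc x' y' t'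
}.

Definition planar (R : realType) (T : finType) (e : rel T) : Prop :=
  exists (pos : T -> R * R) (arc : T -> T -> R -> R * R),
    plane_drawing e pos arc.

(* Main.v *)
Require Import Defs.
From mathcomp Require Import all_boot all_order all_algebra.
From mathcomp Require Import all_classical all_reals all_analysis.
From mathcomp Require Import zify ring lra.

Set Implicit Arguments.
Unset Strict Implicit.
Unset Printing Implicit Defensive.

Import Order.TTheory GRing.Theory Num.Theory.
Import numFieldNormedType.Exports.

(** Two facts are combined by induction on the vertex set.

    Sparseness.  A plane graph of girth at least 8 has fewer than 4/3 as many
    edges as vertices, by Euler's formula, and the same is true of each of its
    induced subgraphs ([planar_sparse]).  If no vertex of such a subcubic
    graph had degree at most 1, no two vertices of degree 2 were adjacent, and
    no vertex of degree 3 had two neighbours of degree 2, then each vertex of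
    degree 2 would have two neighbours of degree 3, each of which it would
    share with no other vertex of degree 2.  So at least two thirds of the
    vertices would have degree 3, and the average degree would be at least
    8/3, which is too much ([unavoidable]).

    Reducibility.  Each of these three configurations can be coloured last
    ([packing_leaf], [packing_two_adjacent], [packing_branch]).  The two
    colours of radius 1 are called near, the two of radius 2 far.  A vertex
    outside the configuration can be recoloured with a near colour as soon as
    no neighbour has this colour; when this fails its neighbours use up so
    many colours that a far colour becomes available inside the configuration.
    Each removed vertex has at most one neighbour that stays, so
    removing the configuration does not separate two remaining vertices that
    were at distance 2.

    The edge bound is obtained from arbitrary continuous arcs without the
    Jordan curve theorem.  Sampling the arcs on a fine square grid realizes
    the graph as a minor of the grid: disjoint connected sets of grid points
    for the vertices, one grid edge for each edge ([drawing_lattice_model]).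
    This only needs that disjoint arcs are at positive distance and that arcs
    are uniformly continuous.  In the grid, the parity of the number of
    crossings of a horizontal ray writes each even set of grid edges as a sum
    of unit squares.  Gluing squares along the grid edges that the minor does
    not use gives faces such that every cycle is a cut of the dual graph and
    the boundary of each face is a cycle ([cycle_cut], [face_cycle]).
    There are at least 2^(|E|-|V|+1) even edge sets, each one is determined by
    the set of faces inside it, and each nonempty face boundary has at
    least g edges, g being the girth, while each edge borders at most two
    faces.  This gives g (|E| - |V| + 1) <= 2 |E| ([edge_bound]). *)

(** * Partial colourings and reducible configurations *)

Section PartialColouring.
Local Open Scope nat_scope.
Variables (T : finType) (e : rel T).
Hypotheses (e_sym : symmetric e) (e_irr : irreflexive e).

(** A colour is a pair: the first component tells whether it is far (radius 2)
    or near (radius 1), the second one is its shade.  Distances are those of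
    the subgraph induced by X. *)
Definition partial_packing (X : {set T}) (c : T -> bool * bool) : Prop :=
  (forall x y, x \in X -> y \in X -> e x y -> c x != c y) /\
  (forall x y z, x \in X -> y \in X -> z \in X -> e z x -> e z y -> x != y ->
     (c x).1 -> c x != c y).

Definition recolour (c : T -> bool * bool) (v : T) (k : bool * bool) : T -> bool * bool :=
  fun x => if x == v then k else c x.

Definition seen (X : {set T}) (c : T -> bool * bool) (x : T) (k : bool * bool) : bool :=
  [exists y in X, e x y && (c y == k)].

Definition near_other (k : bool * bool) : bool * bool := (false, ~~ k.2).

Lemma near_other_neq k : near_other k != k.
Proof. by case: k => -[] []. Qed.

Lemma recolour_same c v k : recolour c v k v = k.
Proof. by rewrite /recolour eqxx. Qed.

Lemma recolour_other c v k x : x != v -> recolour c v k x = c x.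
Proof. by rewrite /recolour => /negPf->. Qed.

Lemma adj_neq x y : e x y -> x != y.
Proof. by apply: contraTneq => ->; rewrite e_irr. Qed.

(** A new vertex can also hurt pairs of old vertices, which it may bring to
    distance 2: hence the last condition. *)
Lemma packing_extend X c v k : partial_packing X c -> v \notin X ->
    (forall u, u \in X -> e v u -> c u != k) ->
    (k.1 -> forall u w, u \in X -> w \in X -> e v u -> e u w -> c w != k) ->
    (forall u w, u \in X -> w \in X -> e v u -> e v w -> u != w ->
       (c u).1 -> c u != c w) ->
  partial_packing (v |: X) (recolour c v k).
Proof.
move=> [c1 c2] vX k1 k2 k3.
have nv x : x \in X -> x != v by apply: contraTneq => ->.
split.
  move=> x y /setU1P[->|xX] /setU1P[->|yX]; rewrite ?recolour_same.
  - by rewrite e_irr.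
  - by move=> vy; rewrite recolour_other ?nv // eq_sym k1.
  - by move=> xv; rewrite recolour_other ?nv // k1 // e_sym.
  - by move=> xy; rewrite !recolour_other ?nv // c1.
move=> x y z /setU1P[->|xX] /setU1P[->|yX] /setU1P[->|zX]; rewrite ?recolour_same ?e_irr //.
- by rewrite eqxx.
- by move=> zv zy _ kf; rewrite recolour_other ?nv // eq_sym (k2 kf z) // e_sym.
- move=> zx zv _; rewrite recolour_other ?nv // => xf; apply/eqP => ck.
  by have /eqP[] := k2 (etrans (congr1 fst (esym ck)) xf) z x zX xX (etrans (e_sym _ _) zv) zx.
- by move=> vx vy xy; rewrite !recolour_other ?nv //; apply: k3.
- by move=> zx zy xy; rewrite !recolour_other ?nv //; apply: c2 zx zy xy.
Qed.

Lemma partial_packingS (X Y : {set T}) c :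
  X \subset Y -> partial_packing Y c -> partial_packing X c.
Proof.
move=> /fintype.subsetP XY [c1 c2]; split=> [x y xX yX|x y z xX yX zX].
  by apply: c1; apply: XY.
by apply: c2; apply: XY.
Qed.

Lemma unseenP X c x k y : ~~ seen X c x k -> y \in X -> e x y -> c y != k.
Proof.
move=> ns yX xy; apply: contraNneq ns => ck.
by apply/existsP; exists y; rewrite yX xy ck eqxx.
Qed.

(** A near colour constrains only the neighbours, so this is the cheap way of
    changing a colouring: remove x and put it back. *)
Lemma packing_recolour_near X c x b : partial_packing X c -> x \in X ->
  ~~ seen X c x (false, b) -> partial_packing X (recolour c x (false, b)).
Proof.
move=> cX xX ns; rewrite -(finset.setD1K xX).
apply: packing_extend => //; first exact: partial_packingS (finset.subsetDl _ _) cX.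
- by rewrite !inE eqxx.
- by move=> u /setD1P[_ uX] xu; apply: unseenP ns uX xu.
- by move=> u w /setD1P[_ uX] /setD1P[_ wX]; case: cX => _; apply.
Qed.

(** A vertex of degree at most 3 with an uncoloured neighbour has at most two
    coloured ones. *)
Lemma seen_bound (X : {set T}) c x u k1 k2 k3 : degree e x <= 3 -> e x u -> u \notin X ->
  seen X c x k1 -> seen X c x k2 -> seen X c x k3 -> ~~ uniq [:: k1; k2; k3].
Proof.
move=> dx xu uX.
move=> /existsP[y1 /and3P[y1X xy1 /eqP<-]] /existsP[y2 /and3P[y2X xy2 /eqP<-]].
move=> /existsP[y3 /and3P[y3X xy3 /eqP<-]].
apply/negP => /(@map_uniq _ _ c [:: y1; y2; y3]) yU.
suff: 4 <= degree e x by rewrite leqNgt ltnS dx.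
rewrite /degree cardE; apply: (@uniq_leq_size _ [:: u; y1; y2; y3]).
  rewrite cons_uniq yU andbT; apply: contra uX; rewrite !inE.
  by move=> /or3P[] /eqP->.
by move=> z; rewrite mem_enum !inE => /or4P[] /eqP->.
Qed.

Lemma unseen_far (X : {set T}) c x u b : degree e x <= 3 -> e x u -> u \notin X ->
  seen X c x (false, b) -> exists d, ~~ seen X c x (true, d).
Proof.
move=> dx xu uX s1; case: (boolP (seen X c x (true, true))) => [s2|]; last by exists true.
exists false; apply/negP => s3; have := seen_bound dx xu uX s1 s2 s3.
by case: b {s1}.
Qed.

(** Whatever the colour of the only neighbour, one near colour differs from it. *)
Lemma packing_leaf (X : {set T}) c v u : v \in X -> (forall y, y \in X -> e v y -> y = u) ->
  partial_packing (X :\ v) c -> exists c', partial_packing X c'.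
Proof.
move=> vX vN cX; exists (recolour c v (near_other (c u))); rewrite -(finset.setD1K vX).
apply: packing_extend => //; first by rewrite !inE eqxx.
  by move=> y /setD1P[_ yX] vy; rewrite (vN y) // eq_sym near_other_neq.
move=> y w /setD1P[_ yX] /setD1P[_ wX] vy vw.
by rewrite (vN y) // (vN w) // eqxx.
Qed.

Lemma packing_extend_edge (X : {set T}) c u v u' v' ku kv :
    u \notin X -> v \notin X -> e u v ->
    (forall y, y \in X -> e u y -> y = u') ->
    (forall y, y \in X -> e v y -> y = v') ->
    ~~ kv.1 -> kv != c v' -> ku != c u' -> ku != kv ->
    (ku.1 -> ~~ seen X c u' ku /\ ku != c v') ->
  partial_packing X c -> exists c', partial_packing (u |: (v |: X)) c'.
Proof.
move=> uX vX uv uN vN kvn kvv kuu kuv kuf cX.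
have nv x : x \in X -> x != v by apply: contraTneq => ->.
have cv : partial_packing (v |: X) (recolour c v kv).
  apply: packing_extend => //.
  - by move=> y yX vy; rewrite (vN y) // eq_sym.
  - by move=> kf; rewrite kf in kvn.
  - by move=> y w yX wX vy vw; rewrite (vN y) // (vN w) // eqxx.
exists (recolour (recolour c v kv) u ku); apply: packing_extend => //.
- by rewrite !inE negb_or uX adj_neq.
- move=> y /setU1P[->|yX] uy; first by rewrite recolour_same eq_sym.
  by rewrite recolour_other ?nv // (uN y) // eq_sym.
- move=> kf; have [ns kuv'] := kuf kf.
  have kuE : kv != ku by rewrite eq_sym.
  move=> y w /setU1P[->|yX] /setU1P[->|wX] uy yw; rewrite ?recolour_same ?recolour_other ?nv //.
  + by rewrite (vN w) // eq_sym.
  + by apply: unseenP ns wX _; rewrite -(uN y).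
- move=> y w /setU1P[->|yX] /setU1P[->|wX] uy uw; rewrite ?eqxx // ?recolour_same.
  + by rewrite (negPf kvn).
  + move=> _; rewrite recolour_other ?nv // => yf.
    by apply: contraNneq kvn => <-.
  + by rewrite (uN y) // (uN w) // eqxx.
Qed.

(** Near colours suffice for u and v unless u' and v' have the same near
    colour.  Then u' can be recoloured with the other near colour, or it sees
    that colour and therefore misses a far colour, which u can take. *)
Lemma packing_two_adjacent (X : {set T}) c u v u' v' :
    u \notin X -> v \notin X -> u' \in X -> v' \in X -> u' != v' ->
    degree e u' <= 3 -> e u v -> e u u' ->
    (forall y, y \in X -> e u y -> y = u') ->
    (forall y, y \in X -> e v y -> y = v') ->
  partial_packing X c -> exists c', partial_packing (u |: (v |: X)) c'.
Proof.
move=> uX vX u'X v'X uv' du' uv uu' uN vN cX.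
have [E|ne] := altP (near_other (c v') =P near_other (c u')); last first.
  by apply: (packing_extend_edge uX vX uv uN vN _ (near_other_neq _) (near_other_neq _) _ _ cX);
    rewrite // eq_sym.
have [kf|] := boolP (c v').1.
  apply: (packing_extend_edge (ku := near_other (c u')) (kv := (false, (c u').2)) uX vX uv uN vN _ _ _ _ _ cX) => //.
  - by apply: contraTneq kf => <-.
  - exact: near_other_neq.
  - by rewrite /near_other xpair_eqE eqxx /=; case: (c u').2.
have [kf|] := boolP (c u').1.
  move=> _; apply: (packing_extend_edge (ku := (false, (c v').2)) (kv := near_other (c v')) uX vX uv uN vN _ _ _ _ _ cX) => //.
  - exact: near_other_neq.
  - by apply: contraTneq kf => <-.
  - by rewrite /near_other xpair_eqE eqxx /=; case: (c v').2.
case Eu: (c u') E => [[] b] //; case Ev: (c v') => [[] b'] //= [/negb_inj Eb] _ _.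
rewrite {}Eb in Ev.
have [s|ns] := boolP (seen X c u' (false, ~~ b)).
  have [|d nd] := unseen_far du' _ uX s; first by rewrite e_sym.
  apply: (packing_extend_edge (ku := (true, d)) (kv := (false, ~~ b)) uX vX uv uN vN _ _ _ _ _ cX);
    rewrite ?Eu ?Ev //.
  by case: (b).
have cX' := packing_recolour_near cX u'X ns.
apply: (packing_extend_edge (ku := (false, b)) (kv := (false, ~~ b)) uX vX uv uN vN _ _ _ _ _ cX') => //;
  rewrite ?recolour_same ?recolour_other 1?eq_sym // ?Ev //.
all: by case: (b).
Qed.

(** The third configuration: v has neighbours u1, u2, w, and u1, u2 have
    degree 2 with other neighbours u1', u2'. *)
Section Branch.
Variables (X : {set T}) (v u1 u2 w u1' u2' : T).
Hypotheses (vX : v \notin X) (u1X : u1 \notin X) (u2X : u2 \notin X).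
Hypotheses (vu1 : v != u1) (vu2 : v != u2) (u12 : u1 != u2).
Hypotheses (wX : w \in X) (u1'X : u1' \in X) (u2'X : u2' \in X).
Hypotheses (wu1' : w != u1') (wu2' : w != u2') (u12' : u1' != u2').
Hypotheses (vw : e v w) (u1u1' : e u1 u1') (u2u2' : e u2 u2').
Hypotheses (nu12 : ~~ e u1 u2).
Hypotheses (vN : forall y, y \in X -> e v y -> y = w).
Hypotheses (u1N : forall y, y \in X -> e u1 y -> y = u1').
Hypotheses (u2N : forall y, y \in X -> e u2 y -> y = u2').
Hypotheses (deg3 : forall x, degree e x <= 3).

Lemma packing_extend_branch (c : T -> bool * bool) kv k1 k2 :
    kv != c w -> k1 != kv -> k2 != kv -> k1 != c u1' -> k2 != c u2' ->
    (kv.1 -> [/\ ~~ seen X c w kv, kv != c u1' & kv != c u2']) ->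
    (k1.1 -> [/\ ~~ seen X c u1' k1, k1 != c w & k1 != k2]) ->
    (k2.1 -> ~~ seen X c u2' k2 /\ k2 != c w) ->
  partial_packing X c -> exists c', partial_packing (u2 |: (u1 |: (v |: X))) c'.
Proof.
move=> kvw k1v k2v k1u k2u kvf k1f k2f cX.
have nv x : x \in X -> x != v by apply: contraTneq => ->.
have nu1 x : x \in X -> x != u1 by apply: contraTneq => ->.
have cv : partial_packing (v |: X) (recolour c v kv).
  apply: packing_extend => //.
  - by move=> y yX vy; rewrite (vN yX) // eq_sym.
  - move=> /kvf[ns _ _] y z yX zX vy yz; apply: unseenP ns zX _.
    by rewrite -(vN yX vy).
  - by move=> y z yX zX vy vz; rewrite (vN yX) // (vN zX) // eqxx.
have cu1 : partial_packing (u1 |: (v |: X)) (recolour (recolour c v kv) u1 k1).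
  apply: packing_extend => //.
  - by rewrite !inE negb_or eq_sym vu1.
  - move=> y /setU1P[->|yX] uy; first by rewrite recolour_same eq_sym.
    by rewrite recolour_other ?nv // (u1N yX) // eq_sym.
  - move=> /k1f[ns nw _] y z /setU1P[->|yX] /setU1P[->|zX] uy yz;
      rewrite ?recolour_same ?recolour_other ?nv //.
    + by rewrite eq_sym.
    + by rewrite (vN zX) // eq_sym.
    + by rewrite eq_sym.
    + by apply: unseenP ns zX _; rewrite -(u1N yX).
  - move=> y z /setU1P[->|yX] /setU1P[->|zX] uy uz; rewrite ?eqxx // ?recolour_same.
    + by move=> _ /kvf[_ nu _]; rewrite recolour_other ?nv // (u1N zX).
    + move=> _; rewrite recolour_other ?nv // (u1N yX) // => yf.
      by apply/eqP => E; rewrite E in yf; have [_ /eqP[]] := kvf yf.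
    + by rewrite (u1N yX) // (u1N zX) // eqxx.
have nvu1' : ~~ e v u1' by apply/negP => /(vN u1'X) E; move: wu1'; rewrite E eqxx.
have nvu2' : ~~ e v u2' by apply/negP => /(vN u2'X) E; move: wu2'; rewrite E eqxx.
have nuu2' : ~~ e u1 u2' by apply/negP => /(u1N u2'X) E; move: u12'; rewrite E eqxx.
set c1 := recolour _ u1 k1 in cu1.
have c1v : c1 v = kv by rewrite /c1 recolour_other // recolour_same.
have c1u1 : c1 u1 = k1 by rewrite /c1 recolour_same.
have c1X x : x \in X -> c1 x = c x.
  by move=> xX; rewrite /c1 !recolour_other ?nv ?nu1.
exists (recolour c1 u2 k2); apply: packing_extend => //.
- by rewrite !inE !negb_or eq_sym u12 eq_sym vu2.
- move=> y /setU1P[->|/setU1P[->|yX]] uy.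
  + by rewrite e_sym (negPf nu12) in uy.
  + by rewrite c1v eq_sym.
  + by rewrite c1X // (u2N yX) // eq_sym.
- move=> kf; have [ns nw] := k2f kf.
  move=> y z /setU1P[->|/setU1P[->|yX]] zY uy yz.
  + by rewrite e_sym (negPf nu12) in uy.
  + case/setU1P: zY yz => [->|/setU1P[->|zX]] yz; rewrite ?c1u1 ?c1v ?c1X //.
    * by apply/eqP => E; rewrite -E in kf; have [_ _ /eqP[]] := k1f kf.
    * by rewrite eq_sym.
    * by rewrite (vN zX) // eq_sym.
  + move: yz; rewrite (u2N yX uy) => yz.
    case/setU1P: zY yz => [->|/setU1P[->|zX]] yz.
    * by rewrite e_sym (negPf nuu2') in yz.
    * by rewrite e_sym (negPf nvu2') in yz.
    * by rewrite c1X //; apply: unseenP ns zX yz.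
- move=> y z yY zY uy uz.
  have E t : t \in u1 |: (v |: X) -> e u2 t -> t = v \/ t = u2'.
    case/setU1P => [->|/setU1P[->|tX]] ut; last by right; apply: u2N.
      by rewrite e_sym (negPf nu12) in ut.
    by left.
  case: (E y yY uy) => ->; case: (E z zY uz) => ->; rewrite ?eqxx // ?c1v ?(c1X _ u2'X) // => _.
    by move=> /kvf[].
  by move=> yf; apply/eqP => C; rewrite C in yf; have [_ _ /eqP[]] := kvf yf.
Qed.

(** Let A be the colour of w and B the other near colour.  If u1' and u2' both
    have colour A then u1 and u2 get B, and v gets a far colour that w does not see; if w sees
    both far colours it does not see B, so it can be recoloured with B to free A
    for v.  Otherwise v gets B, and u1, u2 get A, except
    that next to a vertex of colour A a far colour is used unless that vertex can be
    recoloured with B. *)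
Lemma packing_branch_near (c : T -> bool * bool) : partial_packing X c -> ~~ (c w).1 ->
  exists c', partial_packing (u2 |: (u1 |: (v |: X))) c'.
Proof.
move=> cX; case Ew: (c w) => [[] a] // _.
have bn (b : bool) : (false, ~~ b) != (false, b) by case: b.
have [E1|n1] := eqVneq (c u1') (false, a); have [E2|n2] := eqVneq (c u2') (false, a).
- have [s1|ns] := boolP (seen X c w (true, true)); last first.
    by apply: (packing_extend_branch (kv := (true, true)) (k1 := (false, ~~ a))
      (k2 := (false, ~~ a)) _ _ _ _ _ _ _ _ cX); rewrite ?Ew ?E1 ?E2.
  have [s2|ns] := boolP (seen X c w (true, false)); last first.
    by apply: (packing_extend_branch (kv := (true, false)) (k1 := (false, ~~ a))
      (k2 := (false, ~~ a)) _ _ _ _ _ _ _ _ cX); rewrite ?Ew ?E1 ?E2.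
  have ns : ~~ seen X c w (false, ~~ a).
    by apply/negP => s3; have /negP[] := seen_bound (deg3 w) (etrans (e_sym w v) vw) vX s1 s2 s3.
  have cX' := packing_recolour_near cX wX ns.
  by apply: (packing_extend_branch (kv := (false, a)) (k1 := (false, ~~ a))
      (k2 := (false, ~~ a)) _ _ _ _ _ _ _ _ cX') => //;
    rewrite ?recolour_same ?recolour_other 1?eq_sym // ?E1 ?E2 // eq_sym.
- have [s|ns] := boolP (seen X c u1' (false, ~~ a)).
    have [|d nd] := unseen_far (deg3 u1') _ u1X s; first by rewrite e_sym.
    by apply: (packing_extend_branch (kv := (false, ~~ a)) (k1 := (true, d))
      (k2 := (false, a)) _ _ _ _ _ _ _ _ cX) => //; rewrite ?Ew ?E1 // eq_sym.
  have cX' := packing_recolour_near cX u1'X ns.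
  apply: (packing_extend_branch (kv := (false, ~~ a)) (k1 := (false, a))
      (k2 := (false, a)) _ _ _ _ _ _ _ _ cX') => //;
    rewrite ?recolour_same ?recolour_other ?Ew // 1?eq_sym // eq_sym //.
- have [s|ns] := boolP (seen X c u2' (false, ~~ a)).
    have [|d nd] := unseen_far (deg3 u2') _ u2X s; first by rewrite e_sym.
    by apply: (packing_extend_branch (kv := (false, ~~ a)) (k1 := (false, a))
      (k2 := (true, d)) _ _ _ _ _ _ _ _ cX) => //; rewrite ?Ew ?E2 // eq_sym.
  have cX' := packing_recolour_near cX u2'X ns.
  apply: (packing_extend_branch (kv := (false, ~~ a)) (k1 := (false, a))
      (k2 := (false, a)) _ _ _ _ _ _ _ _ cX') => //;
    rewrite ?recolour_same ?recolour_other ?Ew // 1?eq_sym // eq_sym //.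
- by apply: (packing_extend_branch (kv := (false, ~~ a)) (k1 := (false, a))
      (k2 := (false, a)) _ _ _ _ _ _ _ _ cX) => //; rewrite ?Ew // eq_sym.
Qed.

(** If the far colour of w cannot be replaced by a near one then w sees both
    near colours, hence not the other far colour.  The latter serves
    for v when u1' and u2' have different near colours, which is the only case
    where near colours do not suffice for v, u1 and u2. *)
Lemma packing_branch (c : T -> bool * bool) : partial_packing X c ->
  exists c', partial_packing (u2 |: (u1 |: (v |: X))) c'.
Proof.
move=> cX; have [|cwn] := boolP (c w).1; last exact: packing_branch_near cX cwn.
case Ew: (c w) => [[] d] // _.
have [s1|ns] := boolP (seen X c w (false, true)); last first.
  by apply: packing_branch_near (packing_recolour_near cX wX ns) _; rewrite recolour_same.
have [s2|ns] := boolP (seen X c w (false, false)); last first.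
  by apply: packing_branch_near (packing_recolour_near cX wX ns) _; rewrite recolour_same.
have ns : ~~ seen X c w (true, ~~ d).
  by apply/negP => s3; have /negP[] := seen_bound (deg3 w) (etrans (e_sym w v) vw) vX s1 s2 s3.
have free (b : bool) : c u1' != (false, b) -> c u2' != (false, b) ->
    exists c', partial_packing (u2 |: (u1 |: (v |: X))) c'.
  have bn : (false, ~~ b) != (false, b) by case: (b).
  move=> n1 n2; by apply: (packing_extend_branch (kv := (false, ~~ b)) (k1 := (false, b))
      (k2 := (false, b)) _ _ _ _ _ _ _ _ cX) => //; rewrite ?Ew // eq_sym.
have [E1|n1] := eqVneq (c u1') (false, true).
  have [E2|n2] := eqVneq (c u2') (false, false).
    by apply: (packing_extend_branch (kv := (true, ~~ d)) (k1 := (false, false))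
      (k2 := (false, true)) _ _ _ _ _ _ _ _ cX); rewrite ?Ew ?E1 ?E2 //; case: (d).
  by apply: (free false); rewrite ?E1.
have [E2|n2] := eqVneq (c u2') (false, true); last exact: (free true).
have [E1|n1'] := eqVneq (c u1') (false, false).
  by apply: (packing_extend_branch (kv := (true, ~~ d)) (k1 := (false, true))
      (k2 := (false, false)) _ _ _ _ _ _ _ _ cX); rewrite ?Ew ?E1 ?E2 //; case: (d).
by apply: (free false); rewrite ?E2.
Qed.
End Branch.
End PartialColouring.

(** * Unavoidable configurations in sparse subcubic graphs *)

Section Reduction.
Local Open Scope nat_scope.
Variables (T : finType) (e : rel T).
Hypotheses (e_sym : symmetric e) (e_irr : irreflexive e).
Hypothesis deg3 : forall x, degree e x <= 3.

Definition inner_degree (X : {set T}) (x : T) : nat := #|[pred y in X | e x y]|.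

Lemma inner_degree_le (X : {set T}) x : inner_degree X x <= 3.
Proof.
by apply: leq_trans (deg3 x); apply: subset_leq_card; apply/fintype.subsetP => y /andP[].
Qed.

Lemma inner_degree1 (X : {set T}) x : inner_degree X x <= 1 ->
  exists u, forall y, y \in X -> e x y -> y = u.
Proof.
move=> /card_le1P d1; case: (pickP [pred y in X | e x y]) => [u uX|no].
  by exists u => y yX xy; apply/eqP; have := d1 u uX y; rewrite !inE yX xy => <-.
by exists x => y yX xy; have := no y; rewrite /= yX xy.
Qed.

Lemma inner_degree2 (X : {set T}) x a : inner_degree X x = 2 -> a \in X -> e x a ->
  exists b, [/\ b \in X, e x b, b != a & forall y, y \in X -> y != a -> e x y -> y = b].
Proof.
move=> d2 aX xa; have := cardD1 a [pred y in X | e x y].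
rewrite -/(inner_degree X x) d2 !inE aX xa => -[] /esym/eqP/card1P[b Eb].
have := Eb b; rewrite !inE eqxx => /and3P[ba bX xb]; exists b; split=> // y yX ya xy.
by have := Eb y; rewrite !inE ya yX xy => /esym/eqP.
Qed.

Lemma inner_degree3 (X : {set T}) x a a' : inner_degree X x = 3 ->
    a \in X -> e x a -> a' \in X -> e x a' -> a != a' ->
  exists b, [/\ b \in X, e x b, b != a, b != a' &
    forall y, y \in X -> y != a -> y != a' -> e x y -> y = b].
Proof.
move=> d3 aX xa a'X xa' aa'; have := cardD1 a [pred y in X | e x y].
rewrite -/(inner_degree X x) d3 !inE aX xa => -[] /esym.
rewrite (cardD1 a') !inE eq_sym aa' a'X xa' => -[] /eqP/card1P[b Eb].
have := Eb b; rewrite !inE eqxx => /and4P[ba' ba bX xb]; exists b; split=> // y yX ya ya' xy.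
by have := Eb y; rewrite !inE ya ya' yX xy => /esym/eqP.
Qed.

(** The hypothesis says that the average degree of the subgraph induced by X
    is less than 8/3. *)
Lemma unavoidable (X : {set T}) :
    3 * (\sum_(x in X) inner_degree X x) < 8 * #|X| ->
  [\/ exists2 v, v \in X & inner_degree X v <= 1,
      exists u v, [/\ u \in X, v \in X, e u v, inner_degree X u = 2 & inner_degree X v = 2] |
      exists v u1 u2, [/\ v \in X, u1 \in X, u2 \in X, u1 != u2 &
        [/\ e v u1, e v u2, inner_degree X v = 3, inner_degree X u1 = 2 & inner_degree X u2 = 2]]].
Proof.
move=> sparse.
have [/existsP[v /andP[vX d1]]|n1] := boolP [exists v in X, inner_degree X v <= 1].
  by apply: Or31; exists v.
have [/existsP[u /existsP[v /and5P[uX vX uv /eqP du /eqP dv]]]|n2] := boolP [exists u, exists v,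
  [&& u \in X, v \in X, e u v, inner_degree X u == 2 & inner_degree X v == 2]].
  by apply: Or32; exists u, v.
apply: Or33.
pose D2 := [pred x in X | inner_degree X x == 2].
have d23 x : x \in X -> inner_degree X x = if D2 x then 2 else 3.
  move=> xX; rewrite /D2 /= xX; have := inner_degree_le X x.
  move: n1; rewrite negb_exists => /forallP/(_ x); rewrite xX /= -ltnNge.
  by case: (inner_degree X x) => [|[|[|[|]]]].
have [/existsP[v /and3P[vX dv]]|n3] := boolP [exists v, [&& v \in X, inner_degree X v == 3 &
    1 < #|[pred y in D2 | e v y]|]].
  move=> /card_gt1P[u1 [u2 []]]; rewrite !inE => /andP[/andP[u1X /eqP d1] vu1] /andP[/andP[u2X /eqP d2] vu2] u12.
  by exists v, u1, u2; split=> //; split=> //; apply/eqP.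
(* Each vertex of inner degree 2 gives its two edges to vertices of inner degree 3, each
   of which receives at most one. *)
suff : 2 * #|D2| <= #|[predD X & D2]|.
  have := cardID D2 X; have -> : #|[predI X & D2]| = #|D2|.
    by apply: eq_card => x; rewrite !inE; case: (x \in X).
  move: sparse; have -> : \sum_(x in X) inner_degree X x = 2 * #|D2| + 3 * #|[predD X & D2]|.
    rewrite (bigID D2) /= -!sum1_card !big_distrr /=; congr (_ + _).
      apply: eq_big => [x|x /andP[xX /= dx]]; first by rewrite !inE andbA andbb.
      by rewrite d23 //= dx.
    apply: eq_big => [x|x /andP[xX /= dx]]; first by rewrite !inE andbC.
    by rewrite d23 //= (negPf dx).
  move: #|D2| #|[predD X & D2]| #|X| => a b n; lia.
have -> : 2 * #|D2| = \sum_(x in D2) \sum_(y in [predD X & D2]) e x y.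
  rewrite -sum1_card big_distrr /=; apply: eq_bigr => x; rewrite inE => /andP[xX /eqP dx].
  rewrite muln1 -[LHS]dx /inner_degree -sum1_card big_mkcond [RHS]big_mkcond /=.
  apply: eq_bigr => y _; rewrite !inE.
  case yX: (y \in X) => //=; rewrite andbT; case xy: (e x y) => /=; last by case: ifP.
  case: eqP => // dy; move: n2; rewrite negb_exists => /forallP/(_ x).
  by rewrite negb_exists => /forallP/(_ y); rewrite xX yX xy dx dy.
rewrite exchange_big /= -sum1_card; apply: leq_sum => y; rewrite inE => /andP[yD yX].
move: n3; rewrite negb_exists => /forallP/(_ y); rewrite yX d23 // (negPf yD : D2 y = false) eqxx /=.
rewrite -leqNgt; apply: leq_trans; rewrite -sum1_card [leqRHS]big_mkcond [leqLHS]big_mkcond /=.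
by apply: leq_sum => x _; rewrite !inE e_sym; case: (_ && _) (e y x) => [] [].
Qed.

Hypothesis no_triangle : forall x y z, e x y -> e y z -> e z x -> False.
Hypothesis no_square : forall x y z t,
  e x y -> e y z -> e z t -> e t x -> x != z -> y != t -> False.
Hypothesis sparse : forall X : {set T}, X != finset.set0 ->
  3 * (\sum_(x in X) inner_degree X x) < 8 * #|X|.

(** A configuration is removed from X, and the rest is coloured by induction.
    Triangles and squares are excluded to keep the vertices around the
    configuration distinct. *)
Theorem sparse_packing (X : {set T}) : exists c, partial_packing e X c.
Proof.
have [n] := ubnP #|X|; elim: n X => // n IHn X; rewrite ltnS => Xn.
have [->|X0] := eqVneq X finset.set0.
  by exists (fun=> (false, false)); split=> x; rewrite inE.
have smaller (Y : {set T}) x : x \in X -> x \notin Y -> {subset Y <= X} -> exists c, partial_packing e Y c.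
  move=> xX xY YX; apply: IHn; apply: leq_trans Xn; apply: proper_card.
  by apply/properP; split; [apply/fintype.subsetP | exists x].
have ne x y : e x y -> x != y by apply: adj_neq e_irr _ _.
case: (unavoidable (sparse X0)).
- move=> [v vX /inner_degree1[u vN]].
  have [||c cX] := smaller (X :\ v) v vX; first by rewrite !inE eqxx.
    by move=> y /setD1P[].
  exact: packing_leaf vX vN cX.
- move=> [u [v [uX vX uv du dv]]].
  have [u' [u'X uu' u'v uN]] := inner_degree2 du vX uv.
  have vu : e v u by rewrite e_sym.
  have [v' [v'X vv' v'u vN]] := inner_degree2 dv uX vu.
  pose Y := X :\ u :\ v.
  have XE : X = u |: (v |: Y).
    by rewrite /Y !finset.setD1K // !inE vX andbT eq_sym ne.
  have [||c cY] := smaller Y u uX; first by rewrite !inE eqxx andbF.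
    by move=> y /setD1P[_ /setD1P[]].
  rewrite XE; apply: (packing_two_adjacent (u' := u') (v' := v') e_sym e_irr _ _ _ _ _ _ _ _ _ _ cY) => //.
  + by rewrite !inE eqxx andbF.
  + by rewrite !inE eqxx.
  + by rewrite !inE u'v u'X eq_sym ne.
  + by rewrite !inE v'u v'X eq_sym ne.
  + by apply/eqP => E; apply: (no_triangle uv vv'); rewrite -E e_sym.
  + by move=> y /setD1P[yv /setD1P[yu yX]]; apply: uN.
  + by move=> y /setD1P[yv /setD1P[yu yX]]; apply: vN.
move=> [v [u1 [u2 [vX u1X u2X u12 [vu1 vu2 dv d1 d2]]]]].
have [w [wX vw wu1 wu2 vN]] := inner_degree3 dv u1X vu1 u2X vu2 u12.
have u1v : e u1 v by rewrite e_sym.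
have u2v : e u2 v by rewrite e_sym.
have [u1' [u1'X u1u1' u1'v u1N]] := inner_degree2 d1 vX u1v.
have [u2' [u2'X u2u2' u2'v u2N]] := inner_degree2 d2 vX u2v.
have n12 : ~~ e u1 u2 by apply/negP => E; apply: (no_triangle vu1 E).
pose Y := X :\ u2 :\ u1 :\ v.
have XE : X = u2 |: (u1 |: (v |: Y)).
  by rewrite /Y !finset.setD1K // !inE ?u12 ?vX ?u1X ?ne.
have [||c cY] := smaller Y v vX; first by rewrite !inE eqxx.
  by move=> y /setD1P[_ /setD1P[_ /setD1P[]]].
rewrite XE; apply: (packing_branch (w := w) (u1' := u1') (u2' := u2') e_sym e_irr _ _ _ _ _ _ _ _ _ _ _ _ _ _ _ _ _ _ _ deg3 cY) => //.
- by rewrite !inE eqxx.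
- by rewrite !inE eqxx andbF.
- by rewrite !inE eqxx !andbF.
- exact: ne.
- exact: ne.
- by rewrite !inE wu1 wu2 wX eq_sym ne.
- rewrite !inE u1'v u1'X eq_sym ne //= andbT.
  by apply/eqP => E; move: n12; rewrite -E u1u1'.
- rewrite !inE u2'v u2'X [u2' == u2]eq_sym (ne u2 u2') //= andbT.
  by apply/eqP => E; move: n12; rewrite e_sym -E u2u2'.
- by apply/eqP => E; apply: (no_triangle vu1 u1u1'); rewrite -E e_sym.
- by apply/eqP => E; apply: (no_triangle vu2 u2u2'); rewrite -E e_sym.
- apply/eqP => E; apply: (no_square vu1 u1u1' _ u2v) => //; last by rewrite eq_sym.
  by rewrite E e_sym.
- by move=> y /setD1P[yv /setD1P[yu1 /setD1P[yu2 yX]]]; apply: vN.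
- by move=> y /setD1P[yv /setD1P[yu1 /setD1P[yu2 yX]]]; apply: u1N.
- by move=> y /setD1P[yv /setD1P[yu1 /setD1P[yu2 yX]]]; apply: u2N.
Qed.
End Reduction.

(** * Cycle spaces and abstract duals *)

Section MinDegreeCycle.
Local Open Scope nat_scope.
Variables (V : finType) (r : rel V).
Hypotheses (r_sym : symmetric r) (r_irr : irreflexive r).
Hypothesis r_two : forall x y, r x y -> exists2 y', y' != y & r x y'.

(** A path of maximal length closes up at its first vertex, which has
    a neighbour different from its successor, necessarily on the path. *)
Lemma min_degree_cycle x0 y0 : r x0 y0 -> exists2 c, ucycle r c & 2 < size c.
Proof.
move=> r0; have step n : (exists2 c, ucycle r c & 2 < size c) \/
    exists x p, [/\ path r x p, uniq (x :: p) & size p = n.+1].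
  elim: n => [|n IHn].
    right; exists x0, [:: y0]; split; rewrite /= ?r0 // inE andbT.
    by apply: contraTneq r0 => ->; rewrite r_irr.
  case: IHn => [?|[x [[|y p] [rp up sp]]]]; [by left | by [] |].
  case: (r_two (proj1 (andP rp))) => y' y'y xy'.
  case: (boolP (y' \in x :: y :: p)) => [|y'p]; last first.
    right; exists y', (x :: y :: p); split.
    - by rewrite /= r_sym xy'.
    - by rewrite cons_uniq y'p.
    - by rewrite /= -sp.
  rewrite !inE (negPf y'y) => /orP[/eqP yx|]; first by rewrite yx r_irr in xy'.
  move=> yp; left; case/path.splitP: yp rp up {sp} => p1 p2 rp up.
  exists (x :: y :: rcons p1 y'); last by rewrite /= size_rcons.
  move: rp; rewrite /= cat_path => /and3P[xy yp1 _].
  apply/andP; split; first by rewrite /= xy rcons_path yp1 last_rcons r_sym.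
  by move: up; rewrite -!cat_cons cat_uniq => /and3P[].
case: (step #|V|) => // -[x [p [_ up sp]]].
by have := max_card (mem (x :: p)); rewrite (card_uniqP up) /= sp ltnNge leqnSn.
Qed.
End MinDegreeCycle.

Section Multigraph.
Local Open Scope nat_scope.
Variables (V E : finType) (src tgt : E -> V).

(** Edge sets are boolean functions, and all sums are modulo 2 (addb).  A
    loop has no boundary. *)
Definition boundary (z : E -> bool) (x : V) : bool :=
  \big[addb/false]_(f : E) (z f && ((src f == x) (+) (tgt f == x))).

Definition is_cycle (z : E -> bool) : Prop := boundary z =1 xpred0.

Lemma big_addb_eq1 (I : finType) (i0 : I) (P : pred I) :
  \big[addb/false]_(i : I) (P i && (i0 == i)) = P i0.
Proof.
rewrite (bigD1 i0) //= eqxx andbT big1 ?addbF // => i.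
by rewrite eq_sym => /negPf->; rewrite andbF.
Qed.

Lemma boundaryD z z' x :
  boundary (fun f => z f (+) z' f) x = boundary z x (+) boundary z' x.
Proof. by rewrite /boundary -big_split /=; apply: eq_bigr => f _; rewrite andb_addl. Qed.

Lemma boundary_total z : \big[addb/false]_(x : V) boundary z x = false.
Proof.
rewrite /boundary exchange_big big1 //= => f _.
transitivity (\big[addb/false]_(x : V) ((z f && (src f == x)) (+) (z f && (tgt f == x)))).
  by apply: eq_bigr => x _; rewrite andb_addr.
by rewrite big_split /= !(big_addb_eq1 _ (fun=> z f)) addbb.
Qed.

(** The boundary map takes at most 2^(|V|-1) values, because a boundary is
    determined by its values off v0 ([boundary_total]), and each of its fibres is a translate of
    the cycle space. *)
Lemma card_cycles_ge : 0 < #|V| ->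
  2 ^ #|E| <= 2 ^ #|V|.-1 * #|[pred z : {ffun E -> bool} | `[< is_cycle z >] ]|.
Proof.
move=> /card_gt0P[v0 _]; set Z := [pred z | _].
pose d (z : {ffun E -> bool}) : {ffun V -> bool} :=
  [ffun x => (x != v0) && boundary z x].
have dO z : d z \in pffun_on false (predC1 v0) predT.
  apply/pffun_onP; split=> //; apply/supportP => x /=.
  by rewrite inE negbK ffunE => ->.
have -> : 2 ^ #|E| = #|{ffun E -> bool}| by rewrite card_ffun card_bool.
have -> : 2 ^ #|V|.-1 = #|pffun_on false (predC1 v0) (predT : pred bool)|.
  rewrite card_pffun_on card_bool; congr (_ ^ _).
  by have := cardC1 v0 => <-.
rewrite -sum1_card (partition_big d (mem (pffun_on false (predC1 v0) predT))) //=.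
rewrite -sum_nat_const; apply: leq_sum => g _.
have [z0 /eqP dz0|no] := pickP [pred z | d z == g]; last first.
  by rewrite big1 // => z; have := no z; rewrite /= => ->.
rewrite sum1_card.
pose h (z : {ffun E -> bool}) : {ffun E -> bool} := [ffun f => z f (+) z0 f].
have h_inj : injective h.
  by move=> z z' /ffunP hz; apply/ffunP => f; have := hz f; rewrite !ffunE => /addIb.
rewrite -(card_imset _ h_inj); apply: subset_leq_card; apply/fintype.subsetP => y /imsetP[z].
move=> zg ->; have dz : d z = g by apply/eqP.
apply/asboolP.
have off x : x != v0 -> boundary (h z) x = false.
  move=> xv; have -> : boundary (h z) x = boundary z x (+) boundary z0 x.
    by rewrite -boundaryD; apply: eq_bigr => f _; rewrite ffunE.
  have /ffunP/(_ x) := etrans dz (esym dz0).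
  by rewrite !ffunE xv /= => ->; rewrite addbb.
move=> x; have [->|/off//] := eqVneq x v0.
have := boundary_total (h z); rewrite (bigD1 v0) //= big1; last exact: off.
by rewrite addbF.
Qed.

(** Each edge f separates the faces phi1 f and phi2 f. *)
Section AbstractDual.
Variables (F : finType) (phi1 phi2 : E -> F).
Hypothesis cycle_cut : forall z : E -> bool, is_cycle z ->
  exists w : F -> bool, forall f, z f = w (phi1 f) (+) w (phi2 f).
Hypothesis face_cycle : forall a : F, is_cycle (fun f => (phi1 f == a) (+) (phi2 f == a)).

(** A cycle is the cut of a set w of faces, and only the faces with a
    nonempty boundary influence this cut. *)
Lemma card_cycles_le :
  #|[pred z : {ffun E -> bool} | `[< is_cycle z >] ]| <=
  2 ^ #|[pred a : F | [exists f, (phi1 f == a) (+) (phi2 f == a)]]|.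
Proof.
set A := [pred a : F | _]; rewrite -[2 in leqRHS]card_bool -(card_pffun_on false).
pose cut (w : {ffun F -> bool}) : {ffun E -> bool} :=
  [ffun f => w (phi1 f) (+) w (phi2 f)].
apply: leq_trans (leq_image_card cut _); apply: subset_leq_card.
apply/fintype.subsetP => z /asboolP zc; have [w zw] := cycle_cut zc.
apply/fintype.imageP; exists [ffun a => (a \in A) && w a].
  apply/pffun_onP; split=> //; apply/supportP => a aA; rewrite ffunE.
  by rewrite (negPf aA).
apply/ffunP => f; rewrite !ffunE zw.
have [->|n12] := eqVneq (phi1 f) (phi2 f); first by rewrite !addbb.
have -> : phi1 f \in A.
  by apply/existsP; exists f; rewrite eqxx eq_sym (negPf n12).
by have -> : phi2 f \in A by apply/existsP; exists f; rewrite eqxx (negPf n12).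
Qed.

(** A weak form of Euler's inequality, |E| < |V| + |F|, suffices.  Here |F|
    counts the faces with nonempty boundary; each of them has at least g of
    the 2 |E| sides of edges. *)
Lemma edge_bound g : 0 < #|V| ->
    (forall z, is_cycle z -> (exists f, z f) -> g <= #|[pred f | z f]|) ->
  g * #|E|.+1 <= g * #|V| + 2 * #|E|.
Proof.
move=> V0 girth_g; have := leq_trans (card_cycles_ge V0) (leq_mul (leqnn _) card_cycles_le).
rewrite -expnD leq_exp2l // => EV; set A := [pred a : F | _] in EV.
have gA : g * #|A| <= 2 * #|E|.
  rewrite -sum1_card big_distrr /=.
  apply: (@leq_trans (\sum_(a in A) #|[pred f | (phi1 f == a) (+) (phi2 f == a)]|)).
    by apply: leq_sum => a /existsP[f fa]; rewrite muln1 girth_g //; exists f.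
  apply: (@leq_trans (\sum_(a : F) \sum_(f : E) ((phi1 f == a) + (phi2 f == a)))).
    rewrite big_mkcond; apply: leq_sum => a _; case: ifP => // _.
    rewrite -sum1_card big_mkcond; apply: leq_sum => f _; rewrite inE /=.
    by do 2!case: (_ == a).
  have one (h : E -> F) f : \sum_(a : F) (h f == a) = 1.
    rewrite (bigD1 (h f)) //= eqxx big1 // => a; by rewrite eq_sym => /negPf->.
  rewrite exchange_big /= (eq_bigr (fun=> 2)) => [|f _]; last by rewrite big_split /= !one.
  by rewrite sum_nat_const mulnC.
have := leq_mul (leqnn g) EV; rewrite mulnDr.
by move: V0 gA; case: #|V| => // n _; rewrite /= !mulnS; lia.
Qed.
End AbstractDual.

Definition joins (f : E) : rel V := fun x y =>
  (src f == x) && (tgt f == y) || (src f == y) && (tgt f == x).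

Hypothesis loopless : forall f, src f != tgt f.
Hypothesis simple : forall f f' x y, joins f x y -> joins f' x y -> f = f'.

Definition support_rel (z : E -> bool) : rel V := fun x y => [exists f, z f && joins f x y].

Lemma joins_sym f : symmetric (joins f).
Proof. by move=> x y; rewrite /joins orbC. Qed.

Lemma inc_loopless f x : (src f == x) (+) (tgt f == x) = (src f == x) || (tgt f == x).
Proof.
by case: eqP => //= sx; case: eqP => // tx; have := loopless f; rewrite sx tx eqxx.
Qed.

Lemma odd_card (I : finType) (P : pred I) : odd #|P| = \big[addb/false]_(i : I) P i.
Proof.
rewrite -sum1_card big_mkcond (big_morph odd oddD (erefl _)).
by apply: eq_bigr => i _; rewrite unfold_in; case: (P i).
Qed.

Lemma cycle_two_edges z f x : is_cycle z -> z f -> (src f == x) || (tgt f == x) ->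
  exists f', [/\ f' != f, z f' & (src f' == x) || (tgt f' == x)].
Proof.
move=> zc zf fx; have := zc x; rewrite /boundary -odd_card.
rewrite (cardD1 f) unfold_in zf inc_loopless fx /= => /negbT; rewrite negbK => on.
have /card_gt0P[f'] := odd_gt0 on.
by rewrite inE => /andP[f'f]; rewrite unfold_in inc_loopless => /andP[zf' f'x]; exists f'.
Qed.

(** Every vertex of the support of z has at least two neighbours in it. *)
Lemma cycle_contains_cycle z f : is_cycle z -> z f ->
  exists c, [/\ ucycle (support_rel z) c, 2 < size c & size c <= #|[pred f | z f]|].
Proof.
move=> zc zf.
have r_sym : symmetric (support_rel z).
  by move=> x y; apply: eq_existsb => h; rewrite joins_sym.
have r_irr : irreflexive (support_rel z).
  move=> x; apply/existsP => -[h /andP[_]]; rewrite /joins orbb => /andP[/eqP s /eqP t].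
  by have := loopless h; rewrite s t eqxx.
have end_of h x : (src h == x) || (tgt h == x) -> exists y, joins h x y.
  by case/orP => /eqP <-; [exists (tgt h) | exists (src h)]; rewrite /joins !eqxx ?orbT.
have start h x y : joins h x y -> (src h == x) || (tgt h == x).
  by case/orP => /andP[/eqP s /eqP t]; [rewrite s | rewrite t]; rewrite eqxx ?orbT.
have [||c uc sc] := min_degree_cycle r_sym r_irr _ (_ : support_rel z (src f) (tgt f)).
- move=> x y /existsP[h /andP[zh hxy]].
  have [h' [h'h zh' /end_of[y' h'xy']]] := cycle_two_edges zc zh (start _ _ _ hxy).
  exists y'; last by apply/existsP; exists h'; rewrite zh'.
  by apply: contraNneq h'h => yE; rewrite yE in h'xy'; apply/eqP; apply: simple h'xy' hxy.
- by apply/existsP; exists f; rewrite zf /joins !eqxx.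
exists c; split=> //.
(* Each vertex of the cycle meets two edges of z, and each edge has two ends. *)
rewrite -(leq_pmul2l (isT : 0 < 2)).
apply: (@leq_trans (\sum_(x in c) #|[pred h | z h && ((src h == x) || (tgt h == x))]|)).
  rewrite -(card_uniqP (proj2 (andP uc))) -sum1_card big_distrr /=; apply: leq_sum => x xc.
  have /existsP[h /andP[zh hx]] : support_rel z x (next c x).
    by apply: next_cycle xc; case/andP: uc.
  have [h' [h'h zh' h'x]] := cycle_two_edges zc zh (start _ _ _ hx).
  apply/card_gt1P; exists h, h'; rewrite !inE zh zh' h'x (start _ _ _ hx); split=> //.
  by rewrite eq_sym.
apply: (@leq_trans (\sum_(x : V) \sum_(h in z) ((src h == x) + (tgt h == x)))).
  rewrite big_mkcond; apply: leq_sum => x _; case: ifP => // _.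
  rewrite -sum1_card big_mkcond [leqRHS]big_mkcond; apply: leq_sum => h _; rewrite inE /=.
  by rewrite unfold_in; case: (z h) => //=; do 2!case: (_ == x).
have one (k : E -> V) h : \sum_(x : V) (k h == x) = 1.
  by rewrite (bigD1 (k h)) //= eqxx big1 // => a; rewrite eq_sym => /negPf->.
rewrite exchange_big /= (eq_bigr (fun=> 2)) => [|h _]; last by rewrite big_split /= !one.
by rewrite sum_nat_const mulnC.
Qed.
End Multigraph.

(** * Chains in the square lattice *)

Section LatticeChains.
Local Open Scope nat_scope.

Definition lattice_pt := (nat * nat)%type.
(** Lattice edges are coded by their lower or left end and a direction, true
    for vertical ones. *)
Definition step (d : bool) (p : lattice_pt) : lattice_pt :=
  if d then (p.1, p.2.+1) else (p.1.+1, p.2).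

Definition ladj : rel lattice_pt := fun p q => [exists d : bool, (q == step d p) || (p == step d q)].

Inductive linked (P : pred lattice_pt) (p : lattice_pt) : lattice_pt -> Prop :=
| Linked_refl : linked P p p
| Linked_step q r : linked P p q -> P q -> P r -> ladj q r -> linked P p r.

Definition chain := bool -> nat -> nat -> bool.

(** Boundary at the point (i+1, j+1).  The chains in use avoid the two axes, so
    the shift costs nothing and spares the predecessor. *)
Definition chain_boundary (g : chain) (i j : nat) : bool :=
  g false i.+1 j.+1 (+) g false i j.+1 (+) (g true i.+1 j.+1 (+) g true i.+1 j).

Definition edge_chain (d : bool) (p : lattice_pt) : chain :=
  fun d' i j => (d == d') && (p == (i, j)).

Lemma edge_chain_boundary d p i j :
  chain_boundary (edge_chain d p) i j =
  (p == (i.+1, j.+1)) (+) (step d p == (i.+1, j.+1)).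
Proof.
case: p => a b; rewrite /chain_boundary /edge_chain /step; case: d => /=;
  by rewrite ?addbF //= !xpair_eqE /= !eqSS.
Qed.

Lemma chain_boundaryD g g' i j :
  chain_boundary (fun d i j => g d i j (+) g' d i j) i j =
  chain_boundary g i j (+) chain_boundary g' i j.
Proof.
rewrite /chain_boundary.
by do 4![case: (g _ _ _)]; do 4![case: (g' _ _ _)].
Qed.

Lemma ladj_chain p q : ladj p q -> exists d s,
  (s = p /\ step d s = q) \/ (s = q /\ step d s = p).
Proof. by case/existsP => d /orP[]/eqP->; [exists d, p; left | exists d, q; right]. Qed.

(** The edges of a walk, counted modulo 2, have its ends as boundary. *)
Lemma linked_chain (P : pred lattice_pt) p q : linked P p q -> exists g : chain,
  (forall d i j, g d i j -> P (i, j) && P (step d (i, j))) /\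
  (forall i j, chain_boundary g i j = (p == (i.+1, j.+1)) (+) (q == (i.+1, j.+1))).
Proof.
elim=> [|{}q r _ [g [gP gb]] Pq Pr /ladj_chain[d [s sE]]].
  by exists (fun _ _ _ => false); split=> // i j; rewrite addbb.
have [sP sP'] : P s /\ P (step d s) by case: sE => -[-> ->].
exists (fun d' i j => g d' i j (+) edge_chain d s d' i j); split=> [d' i j|i j].
  have [/gP//|_ /=] := boolP (g d' i j).
  by move=> /andP[/eqP<- /eqP<-]; rewrite sP.
rewrite chain_boundaryD gb edge_chain_boundary.
by case: sE => -[-> ->]; do 3!case: (_ == _).
Qed.

Lemma big_addb_shift N (F : nat -> bool) : F 0 = false -> F N = false ->
  \big[addb/false]_(i < N) F i.+1 = \big[addb/false]_(i < N) F i.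
Proof.
move=> F0 FN; have := big_ord_recl (idx := false) (op := addb) N (fun i : 'I_N.+1 => F i).
by rewrite big_ord_recr /= F0 FN addbF => ->; apply: eq_bigr.
Qed.

(** A closed chain g leaves each finite set A of points an even number of
    times: summing the boundary over A counts the edges inside A twice. *)
Lemma handshake N (g : chain) (A : nat -> nat -> bool) :
    (forall i j, chain_boundary g i j = false) ->
    (forall i j, A i j -> 0 < i < N /\ 0 < j < N) ->
  \big[addb/false]_(l : bool * 'I_N * 'I_N)
     (g l.1.1 l.1.2 l.2 && (A l.1.2 l.2 (+)
        A (step l.1.1 (l.1.2 : nat, l.2 : nat)).1 (step l.1.1 (l.1.2 : nat, l.2 : nat)).2)) = false.
Proof.
move=> gb Abox.
have A0 i j : (i == 0) || (j == 0) || (i == N) || (j == N) -> A i j = false.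
  by move=> ij; apply/negP => /Abox[]; lia.
pose S (F : nat -> nat -> bool) := \big[addb/false]_(i < N) \big[addb/false]_(j < N) F i j.
have SD F G : S (fun i j => F i j (+) G i j) = S F (+) S G.
  by rewrite /S -big_split; apply: eq_bigr => i _; rewrite -big_split.
have shift1 F : (forall j, F 0 j = false) -> (forall j, F N j = false) ->
    S (fun i j => F i.+1 j) = S F.
  move=> F0 FN; rewrite /S exchange_big [RHS]exchange_big; apply: eq_bigr => j _.
  exact: (big_addb_shift (F := F^~ j)).
have shift2 F : (forall i, F i 0 = false) -> (forall i, F i N = false) ->
    S (fun i j => F i j.+1) = S F.
  by move=> F0 FN; apply: eq_bigr => i _; apply: (big_addb_shift (F := F i)).
have SE F G : (forall i j, F i j = G i j) -> S F = S G.
  by move=> FG; apply: eq_bigr => i _; apply: eq_bigr => j _.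
have S0 : S (fun i j => A i.+1 j.+1 && chain_boundary g i j) = false.
  by apply: big1 => i _; apply: big1 => j _; rewrite gb andbF.
pose h := g false; pose v := g true.
have T1 : S (fun i j => A i.+1 j.+1 && h i.+1 j.+1) = S (fun i j => A i j && h i j).
  rewrite (shift2 (fun i j => A i.+1 j && h i.+1 j)) ?(shift1 (fun i j => A i j && h i j)) //;
    by move=> i; rewrite A0 ?eqxx ?orbT.
have T2 : S (fun i j => A i.+1 j.+1 && h i j.+1) = S (fun i j => A i.+1 j && h i j).
  rewrite (shift2 (fun i j => A i.+1 j && h i j)) //;
    by move=> i; rewrite A0 ?eqxx ?orbT.
have T3 : S (fun i j => A i.+1 j.+1 && v i.+1 j.+1) = S (fun i j => A i j && v i j).
  rewrite (shift2 (fun i j => A i.+1 j && v i.+1 j)) ?(shift1 (fun i j => A i j && v i j)) //;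
    by move=> i; rewrite A0 ?eqxx ?orbT.
have T4 : S (fun i j => A i.+1 j.+1 && v i.+1 j) = S (fun i j => A i j.+1 && v i j).
  rewrite (shift1 (fun i j => A i j.+1 && v i j)) //;
    by move=> i; rewrite A0 ?eqxx ?orbT.
move: S0; rewrite (SE _ (fun i j => ((A i.+1 j.+1 && h i.+1 j.+1) (+) (A i.+1 j.+1 && h i j.+1)) (+)
  ((A i.+1 j.+1 && v i.+1 j.+1) (+) (A i.+1 j.+1 && v i.+1 j)))); last first.
  by move=> i j; rewrite /chain_boundary -/h -/v !andb_addr.
rewrite !SD T1 T2 T3 T4 -2!SD /S => S0; apply: etrans S0.
transitivity (\big[addb/false]_(d : bool) \big[addb/false]_(i < N) \big[addb/false]_(j < N)
   (g d i j && (A i j (+) A (step d (i : nat, j : nat)).1 (step d (i : nat, j : nat)).2))).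
  by rewrite pair_big /= pair_big /=.
rewrite big_bool /= addbC; congr (_ (+) _).
  by apply: eq_bigr => i _; apply: eq_bigr => j _; rewrite andb_addr ![_ && g _ _ _]andbC.
by apply: eq_bigr => i _; apply: eq_bigr => j _; rewrite andb_addr ![_ && g _ _ _]andbC.
Qed.
End LatticeChains.

(** * Lattice models and their duals *)

Section LatticeModel.
Local Open Scope nat_scope.
Variables (V E : finType) (src tgt : E -> V).
Hypothesis loopless : forall f, src f != tgt f.
Hypothesis simple : forall f f' x y, joins src tgt f x y -> joins src tgt f' x y -> f = f'.

(** A minor model in the square lattice.  The points labelled x form the
    branch set of the vertex x; labels being functions, branch sets are
    disjoint.  The bounds keep them off the axes and make the set of squares
    finite.  A vertex without edges may have an empty branch set. *)
Record lattice_model (N : nat) (lab : lattice_pt -> option V) (ctr : V -> lattice_pt) : Prop :=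
  LatticeModel {
    lab_box : forall p x, lab p = Some x -> 0 < p.1 < N /\ 0 < p.2 < N;
    lab_linked : forall p x, lab p = Some x -> linked (fun q => lab q == Some x) (ctr x) p;
    lab_edge : forall f, exists p q,
      [/\ ladj p q, lab p = Some (src f) & lab q = Some (tgt f)] }.

Section DualOfModel.
Variables (n : nat) (lab : lattice_pt -> option V) (ctr : V -> lattice_pt).
Hypothesis model : lattice_model n.+1 lab ctr.
Notation N := n.+1.

Definition lattice_edge := (bool * 'I_N * 'I_N)%type.
Definition lstart (l : lattice_edge) : lattice_pt := (l.1.2 : nat, l.2 : nat).
Definition lend (l : lattice_edge) : lattice_pt := step l.1.1 (lstart l).

Lemma lab_ctr p x : lab p = Some x -> lab (ctr x) = Some x.
Proof.
move=> px; have : linked (fun q => lab q == Some x) (ctr x) p by apply: (lab_linked model).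
move=> L; elim: L px => // q r _ IH /eqP qx _ _ _; exact: IH.
Qed.

Lemma crossing_edge_exists f : exists l : lattice_edge,
  (lab (lstart l) = Some (src f) /\ lab (lend l) = Some (tgt f)) \/
  (lab (lstart l) = Some (tgt f) /\ lab (lend l) = Some (src f)).
Proof.
have [p [q [pq px qy]]] := lab_edge model f.
have mk d (s : lattice_pt) x : lab s = Some x ->
    exists l : lattice_edge, lstart l = s /\ lend l = step d s.
  move=> /(lab_box model)[/andP[_ s1] /andP[_ s2]].
  by exists (d, Ordinal s1, Ordinal s2); rewrite /lend /lstart /= -surjective_pairing.
case: (ladj_chain pq) => d [s [] [E1 E2]]; subst s.
  by have [l [ls le]] := mk d _ _ px; exists l; left; rewrite ls le E2.
by have [l [ls le]] := mk d _ _ qy; exists l; right; rewrite ls le E2.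
Qed.

(** The lattice edge that represents f in the minor. *)
Definition crossing (f : E) : lattice_edge :=
  projT1 (cid (crossing_edge_exists f)).

Lemma crossingP f :
  (lab (lstart (crossing f)) = Some (src f) /\ lab (lend (crossing f)) = Some (tgt f)) \/
  (lab (lstart (crossing f)) = Some (tgt f) /\ lab (lend (crossing f)) = Some (src f)).
Proof. exact: projT2 (cid (crossing_edge_exists f)). Qed.

Lemma crossing_joins f : exists x y,
  [/\ lab (lstart (crossing f)) = Some x, lab (lend (crossing f)) = Some y,
      x != y & joins src tgt f x y].
Proof.
case: (crossingP f) => -[s t].
  by exists (src f), (tgt f); rewrite /joins !eqxx loopless.
by exists (tgt f), (src f); rewrite /joins !eqxx orbT eq_sym loopless.
Qed.

Lemma crossing_inj : injective crossing.
Proof.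
move=> f f' ff'; have [x [y [fx fy _ j]]] := crossing_joins f.
have [x' [y' [fx' fy' _ j']]] := crossing_joins f'.
move: fx fy; rewrite ff' fx' fy' => -[xx] [yy]; subst x' y'.
exact: simple j j'.
Qed.

(** The edges of the subgraph of the lattice whose contraction is the graph:
    those inside a branch set and those that represent an edge. *)
Definition drawn (d : bool) (p : lattice_pt) : bool :=
  (isSome (lab p) && (lab p == lab (step d p))) ||
  [exists f, ((crossing f).1.1 == d) && (lstart (crossing f) == p)].

Lemma drawn_pos d i j : drawn d (i, j) -> 0 < i /\ 0 < j.
Proof.
case/orP => [/andP[]|/existsP[f /andP[_ /eqP fij]]].
  by case: (lab (i, j)) (@lab_box _ _ _ model (i, j)) => // x /(_ x erefl)[] /andP[? _] /andP[].
have [x [_ [fx _ _ _]]] := crossing_joins f; rewrite fij in fx.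
by have [/andP[? _] /andP[]] := lab_box model fx.
Qed.

(** Lift of the edge f: a walk from the centre of its source to the
    representing edge, that edge, and a walk to the centre of its
    target.  The walks stay inside branch sets, so they contain no representing edge. *)
Lemma edge_chain_exists f : exists g : chain,
  [/\ forall d i j, g d i j -> drawn d (i, j),
      forall f', g (crossing f').1.1 (crossing f').1.2 (crossing f').2 = (f' == f) &
      forall i j, chain_boundary g i j =
        (ctr (src f) == (i.+1, j.+1)) (+) (ctr (tgt f) == (i.+1, j.+1))].
Proof.
have [x [y [fx fy xy jn]]] := crossing_joins f.
have [gx [gxP gxb]] := linked_chain (lab_linked model fx).
have [gy [gyP gyb]] := linked_chain (lab_linked model fy).
set l := crossing f in fx fy gxb gyb.
exists (fun d i j => gx d i j (+) gy d i j (+) edge_chain l.1.1 (lstart l) d i j).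
have inside d i j z : lab (i, j) == Some z -> lab (step d (i, j)) == Some z -> drawn d (i, j).
  by rewrite /drawn => /eqP-> /eqP->; rewrite eqxx.
split.
- move=> d i k.
  have [/gxP/andP[gxs gxe] _|_] := boolP (gx d i k); first exact: inside gxs gxe.
  have [/gyP/andP[gys gye] _|_] := boolP (gy d i k); first exact: inside gys gye.
  by move=> /= lP; apply/orP; right; apply/existsP; exists f.
- move=> f'; have [x' [y' [fx' fy' xy' j']]] := crossing_joins f'.
  have off (z : V) (g : chain) : (forall d i j, g d i j ->
      (lab (i, j) == Some z) && (lab (step d (i, j)) == Some z)) ->
      g (crossing f').1.1 (crossing f').1.2 (crossing f').2 = false.
    move=> gP; apply/negP => /gP/andP[].
    rewrite -/(lstart (crossing f')) -/(lend (crossing f')) fx' fy' => /eqP[xz] /eqP[yz].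
    by rewrite xz yz eqxx in xy'.
  rewrite (off x) // (off y) // /= /edge_chain.
  rewrite -/(lstart (crossing f')); apply/idP/eqP => [|->]; last by rewrite !eqxx.
  move=> /andP[/eqP ld /eqP ls]; apply/esym/crossing_inj.
  move: ld ls; rewrite -/l /lstart; case: l {fx fy gxb gyb} => -[d a] b /=.
  by case: (crossing f') => -[d' a'] b' /= -> [] /val_inj -> /val_inj ->.
- move=> i k; rewrite !chain_boundaryD gxb gyb edge_chain_boundary -/(lend l).
  case/orP: jn => /andP[/eqP-> /eqP->].
    by do 4!case: (_ == _).
  by do 4!case: (_ == _).
Qed.

(** A square is named after its lower left corner.  The sides of a lattice edge are the
    square of the same name and its left or lower neighbour; for edges on the
    axes, which are never drawn, both sides are the same square. *)
Definition side1 (l : lattice_edge) : 'I_N * 'I_N := (l.1.2, l.2).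
Definition side2 (l : lattice_edge) : 'I_N * 'I_N :=
  if l.1.1 then (inord l.1.2.-1, l.2) else (l.1.2, inord l.2.-1).

Definition same_face : rel ('I_N * 'I_N) := fun s s' =>
  [exists l, ~~ drawn l.1.1 (lstart l) &&
     ((side1 l == s) && (side2 l == s') || (side1 l == s') && (side2 l == s))].

Lemma same_face_sym : connect_sym same_face.
Proof.
by apply: sym_connect_sym => s s'; apply: eq_existsb => l; rewrite orbC.
Qed.

Definition face (s : 'I_N * 'I_N) : 'I_N * 'I_N := fingraph.root same_face s.

Lemma face_sides l : ~~ drawn l.1.1 (lstart l) -> face (side1 l) = face (side2 l).
Proof.
move=> nl; apply/fingraph.rootP; first exact: same_face_sym.
by apply: connect1; apply/existsP; exists l; rewrite nl !eqxx.
Qed.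

(** The sum of the squares of a face is a closed chain that avoids all
    undrawn edges, because these do not separate faces.  So it leaves the
    branch set of x only through edges that represent edges at x. *)
Lemma face_cycle a : is_cycle src tgt (fun f =>
  (face (side1 (crossing f)) == a) (+) (face (side2 (crossing f)) == a)).
Proof.
move=> x; pose chi i j := face (inord i, inord j) == a.
pose g : chain := fun d i j => chi i j (+) (if d then chi i.-1 j else chi i j.-1).
have gE (l : lattice_edge) : g l.1.1 l.1.2 l.2 = (face (side1 l) == a) (+) (face (side2 l) == a).
  by rewrite /g /chi /side1 /side2 !inord_val; case: (l.1.1).
have gb i j : chain_boundary g i j = false.
  by rewrite /chain_boundary /g /=; do 4!case: (chi _ _).
pose A i j := lab (i, j) == Some x.
have := handshake (N := N) (A := A) gb (fun i j (P : A i j) => lab_box model (eqP P)).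
rewrite (bigID [pred l | l \in codom crossing]) /= [X in _ (+) X]big1 ?addbF; last first.
  move=> l nl; rewrite gE /A -surjective_pairing -/(lstart l) -/(lend l).
  have [dl|/face_sides->] := boolP (drawn l.1.1 (lstart l)); last by rewrite addbb.
  case/orP: dl => [/andP[_ /eqP->]|]; first by rewrite addbb andbF.
  move=> /existsP[f /andP[/eqP fd /eqP fs]]; case/negP: nl.
  apply/codomP; exists f; move: fd fs; rewrite /lstart.
  by case: (l) => -[d i] j; case: (crossing f) => -[d' i'] j' /= -> [] /val_inj -> /val_inj ->.
rewrite -big_filter (perm_big (codom crossing)) /=; last first.
  apply: uniq_perm; first by rewrite filter_uniq ?index_enum_uniq.
  - by rewrite codomE map_inj_uniq ?enum_uniq //; apply: crossing_inj.
  - by move=> l; rewrite mem_filter mem_index_enum andbT.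
rewrite codomE big_map big_enum /= => sum0; rewrite /boundary -[RHS]sum0.
apply: eq_bigr => f _; rewrite gE; congr (_ && _).
rewrite /A -surjective_pairing -/(lstart (crossing f)) -/(lend (crossing f)).
by case: (crossingP f) => -[-> ->] //; rewrite addbC.
Qed.

(** The lifts of the edges of z add up to a closed chain c, since their ends
    cancel at the centres.  Let w be the parity of the number of vertical
    edges of c met by the ray from a square to the left.  Then w differs on the two
    sides of a lattice edge exactly when c contains it: by definition for
    vertical edges, by induction along the ray for horizontal ones.  As c is drawn, w is
    constant on faces. *)
Lemma cycle_cut z : is_cycle src tgt z -> exists w : 'I_N * 'I_N -> bool,
  forall f, z f = w (face (side1 (crossing f))) (+) w (face (side2 (crossing f))).
Proof.
move=> zc; have [G GP] := boolp.choice edge_chain_exists.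
pose c : chain := fun d i j => \big[addb/false]_f (z f && G f d i j).
have cr f : c (crossing f).1.1 (crossing f).1.2 (crossing f).2 = z f.
  rewrite /c (eq_bigr (fun f' => z f' && (f == f'))) ?big_addb_eq1 // => f' _.
  by have [_ ->] := GP f'.
have cd d i j : c d i j -> drawn d (i, j).
  apply: contraTT => nd; rewrite /c big1 // => f _.
  by apply/negbTE; apply: contra nd => /andP[_]; have [Gd _ _] := GP f; apply: Gd.
have cb i j : chain_boundary c i j = false.
  have -> : chain_boundary c i j =
      \big[addb/false]_f (z f && ((ctr (src f) == (i.+1, j.+1)) (+) (ctr (tgt f) == (i.+1, j.+1)))).
    rewrite /chain_boundary /c -!big_split /=; apply: eq_bigr => f _.
    by have [_ _ <-] := GP f; rewrite /chain_boundary -!andb_addr.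
  have lab_end f : lab (ctr (src f)) = Some (src f) /\ lab (ctr (tgt f)) = Some (tgt f).
    by have [p [q [_ /lab_ctr-> /lab_ctr->]]] := lab_edge model f.
  case: (pickP [pred x | (lab (i.+1, j.+1) == Some x) && (ctr x == (i.+1, j.+1))]) => [x|no].
    move=> /andP[/eqP px /eqP cx]; rewrite -[RHS](zc x); apply: eq_bigr => f _.
    have [ls lt] := lab_end f; congr (_ && (_ (+) _)); apply/eqP/eqP => [ce|->] //.
      by move: px; rewrite -ce ls => -[].
    by move: px; rewrite -ce lt => -[].
  apply: big1 => f _; have [ls lt] := lab_end f.
  have -> : (ctr (src f) == (i.+1, j.+1)) = false.
    by apply/negP => ce; have := no (src f); rewrite /= ce -(eqP ce) ls eqxx.
  have -> : (ctr (tgt f) == (i.+1, j.+1)) = false.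
    by apply/negP => ce; have := no (tgt f); rewrite /= ce -(eqP ce) lt eqxx.
  by rewrite andbF.
have c0 d i j : (i == 0) || (j == 0) -> c d i j = false.
  by move=> ij; apply/negP => /cd/drawn_pos; lia.
pose w i j := \big[addb/false]_(k < i.+1) c true k j.
have wv i j : w i j (+) w i.+1 j = c true i.+1 j.
  by rewrite [w i.+1 j]/w big_ord_recr /= -/(w i j) addKb.
have wh i j : w i j.+1 (+) w i j = c false i j.+1.
  elim: i => [|i IH]; first by rewrite /w !big_ord_recr !big_ord0 /= !c0.
  have := cb i j; rewrite /chain_boundary -IH -!wv.
  by do 2!case: (w i _); do 2!case: (w i.+1 _); case: (c _ _ _).
pose W (s : 'I_N * 'I_N) := w s.1 s.2.
have Wsides (l : lattice_edge) : W (side1 l) (+) W (side2 l) = c l.1.1 l.1.2 l.2.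
  case: l => -[d i] j; rewrite /side1 /side2 /W /=; case: d => /=.
    rewrite inordK; last by rewrite (leq_ltn_trans (leq_pred _)).
    by case: (val i) => [|k] /=; [rewrite addbb c0 | rewrite addbC wv].
  rewrite inordK; last by rewrite (leq_ltn_trans (leq_pred _)).
  by case: (val j) => [|k] /=; [rewrite addbb c0 ?orbT | rewrite wh].
have Wface s : W (face s) = W s.
  have : connect same_face s (face s) by exact: connect_root.
  move=> /connectP[p + ->]; elim: p s => //= s' p IH s /andP[ss' /IH->].
  case/existsP: ss' => l /andP[nl sl].
  have /eqP : W (side1 l) (+) W (side2 l) = false.
    by rewrite Wsides; apply/negP => /cd; apply/negP.
  by case/orP: sl => /andP[/eqP-> /eqP->]; do 2!case: (W _).
by exists W => f; rewrite !Wface Wsides cr.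
Qed.
End DualOfModel.

End LatticeModel.

(** * Continuous curves in the plane *)

Section PlaneCurves.
Local Open Scope classical_set_scope.
Local Open Scope ring_scope.
Variable R : realType.

(** Composition with this retraction onto [0, 1] replaces arcs, which are only
    continuous within [0, 1], by functions continuous on the whole line. *)
Definition clamp (t : R) : R := Num.max 0 (Num.min 1 t).

Lemma clamp_itv t : clamp t \in `[0, 1].
Proof.
by rewrite in_itv /= /clamp le_max lexx /= ge_max ler01 ge_min lexx.
Qed.

Lemma clamp_id t : t \in `[0, 1] -> clamp t = t.
Proof.
by rewrite in_itv /= => /andP[t0 t1]; rewrite /clamp min_r // max_r.
Qed.

Lemma clamp_continuous : continuous clamp.
Proof.
move=> t; apply: (@continuous_max R R (cst 0) (cst 1 \min id)); first exact: cvg_cst.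
by apply: (@continuous_min R R (cst 1) id); [exact: cvg_cst | exact: cvg_id].
Qed.

Lemma continuous_clamp (f : R -> R * R) : {within `[0, 1], continuous f} ->
  continuous (f \o clamp).
Proof.
move=> /subspace_continuousP fc t; have := fc (clamp t) (clamp_itv t).
apply: cvg_trans => P nP.
have nQ : nbhs (clamp t) [set s | s \in `[0, 1] -> P (f s)] by exact: nP.
have := clamp_continuous nQ.
change (nbhs t (clamp @^-1` [set s | s \in `[0, 1] -> P (f s)]) -> nbhs t ((f \o clamp) @^-1` P)).
by apply: filterS => s; apply; exact: clamp_itv.
Qed.

Definition pdist (p q : R * R) : R := `|p.1 - q.1| + `|p.2 - q.2|.

Lemma pdist_gt0 p q : p <> q -> 0 < pdist p q.
Proof.
move=> pq; rewrite lt_neqAle addr_ge0 // andbT eq_sym paddr_eq0 //.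
rewrite !normr_eq0 !subr_eq0 -xpair_eqE -!surjective_pairing; exact/eqP.
Qed.

Lemma pdist_continuous (f g : R -> R * R) : continuous f -> continuous g ->
  continuous (fun st : R * R => pdist (f st.1) (g st.2)).
Proof.
move=> fc gc st.
have f1 : (fun st : R * R => (f st.1)) @ st --> f st.1.
  by apply: (cvg_comp fst f); [exact: cvg_fst | exact: fc].
have g1 : (fun st : R * R => (g st.2)) @ st --> g st.2.
  by apply: (cvg_comp snd g); [exact: cvg_snd | exact: gc].
apply: cvgD; apply: cvg_norm; apply: cvgB.
- by apply: (cvg_comp _ fst f1); exact: cvg_fst.
- by apply: (cvg_comp _ fst g1); exact: cvg_fst.
- by apply: (cvg_comp _ snd f1); exact: cvg_snd.
- by apply: (cvg_comp _ snd g1); exact: cvg_snd.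
Qed.

(** Both the distance between disjoint arcs and uniform continuity come from
    this bound, applied to a product of segments and to the compact set of
    pairs of parameters whose images are far apart. *)
Lemma compact_gt0 (K : set (R * R)) (phi : R * R -> R) : compact K -> continuous phi ->
  (forall p, K p -> 0 < phi p) -> exists2 d, 0 < d & forall p, K p -> d <= phi p.
Proof.
move=> cK cphi phi0; have [K0|/set0P K0] := eqVneq K set0.
  by exists 1 => // p; rewrite K0.
have [c cin cmin] := compact_EVT_min K0 cK (continuous_subspaceT cphi).
exists (phi c); first by apply: phi0; exact: set_mem cin.
by move=> p Kp; apply: cmin; rewrite inE.
Qed.

Lemma curves_apart (f g : R -> R * R) (a b : R) : continuous f -> continuous g ->
    (forall s t, s \in `[0, a] -> t \in `[0, b] -> f s <> g t) ->
  exists2 d, 0 < d & forall s t, s \in `[0, a] -> t \in `[0, b] -> d <= pdist (f s) (g t).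
Proof.
move=> fc gc fg; have cK := compact_setX (@segment_compact R 0 a) (@segment_compact R 0 b).
have [[s t] [/= sa tb]|d d0 dK] := compact_gt0 cK (pdist_continuous fc gc) _.
  by apply/pdist_gt0/fg.
by exists d => // s t sa tb; apply: (dK (s, t)).
Qed.

Lemma curve_uniform (f : R -> R * R) (eps : R) : continuous f -> 0 < eps ->
  exists2 d, 0 < d & forall s t, s \in `[0, 1] -> t \in `[0, 1] ->
    `|s - t| < d -> pdist (f s) (f t) < eps.
Proof.
move=> fc eps0.
have cK := compact_setX (@segment_compact R 0 1) (@segment_compact R 0 1).
have clK : closed [set st : R * R | eps <= pdist (f st.1) (f st.2)].
  apply: (@closed_comp _ _ _ [set x : R | eps <= x]); last exact: closed_ge.
  by move=> st _; exact: pdist_continuous.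
have dc : continuous (fun st : R * R => `|st.1 - st.2|).
  by move=> st; apply: cvg_norm; apply: cvgB; [exact: cvg_fst | exact: cvg_snd].
have [[s t] [[/= s1 t1] far]|d d0 dK] := compact_gt0 (compact_closedI cK clK) dc _.
  rewrite normr_gt0 subr_eq0; apply/eqP => st.
  by move: far; rewrite /= st /pdist !subrr normr0 addr0 leNgt eps0.
exists d => // s t s1 t1 std; rewrite ltNge; apply/negP => far.
by move: std; rewrite ltNge (dK (s, t)).
Qed.

Lemma curve_bounded (f : R -> R * R) : continuous f ->
  exists M, forall t, t \in `[0, 1] -> `|(f t).1| <= M /\ `|(f t).2| <= M.
Proof.
move=> fc.
have c1 : continuous (fun t => `|(f t).1|).
  by move=> t; apply: cvg_norm; apply: (cvg_comp f fst); [exact: fc | exact: cvg_fst].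
have c2 : continuous (fun t => `|(f t).2|).
  by move=> t; apply: cvg_norm; apply: (cvg_comp f snd); [exact: fc | exact: cvg_snd].
have [t1 _ M1] := EVT_max ler01 (continuous_subspaceT c1).
have [t2 _ M2] := EVT_max ler01 (continuous_subspaceT c2).
exists (Num.max `|(f t1).1| `|(f t2).2|) => t t01.
by rewrite !le_max M1 // M2 // orbT.
Qed.
End PlaneCurves.

(** * From disjoint lattice walks to a lattice model *)

Section OrientedEdges.
Local Open Scope nat_scope.
Variables (V : finType) (e : rel V).
Hypotheses (e_irr : irreflexive e).

(** Each edge is kept in one of its two orientations, chosen by an enumeration of
    the vertices. *)
Definition oriented (p : V * V) : bool := e p.1 p.2 && (enum_rank p.1 < enum_rank p.2).
Definition edge_type := {p : V * V | oriented p}.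
Definition esrc (f : edge_type) : V := (val f).1.
Definition etgt (f : edge_type) : V := (val f).2.

Lemma oriented_total x y : e x y -> oriented (x, y) || (enum_rank y < enum_rank x).
Proof.
rewrite /oriented /= => xy; rewrite xy; case: ltngtP => //= r.
by move: xy; rewrite (enum_rank_inj (ord_inj r)) e_irr.
Qed.

Lemma oriented_asym x y : oriented (x, y) -> ~~ oriented (y, x).
Proof. by rewrite /oriented /= => /andP[_ xy]; rewrite negb_and -leqNgt (ltnW xy) orbT. Qed.

Lemma edge_loopless f : esrc f != etgt f.
Proof.
case: f => -[x y] xy; rewrite /esrc /etgt /=.
by apply: contraTneq (proj1 (andP xy)) => /= ->; rewrite e_irr.
Qed.

Lemma edge_simple f f' x y : joins esrc etgt f x y -> joins esrc etgt f' x y -> f = f'.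
Proof.
case: f f' => [[a b] ab] [[a' b'] ab']; rewrite /joins /esrc /etgt /= => j j'.
apply: val_inj => /=; move: (oriented_asym ab) (oriented_asym ab').
by case/orP: j => /andP[/eqP ax /eqP yb]; case/orP: j' => /andP[/eqP ax' /eqP yb'];
  subst a b a' b'; rewrite ?ab ?ab'.
Qed.
End OrientedEdges.

(** The walk q x y follows the arc from x to y for two thirds of its length,
    in 2a steps; its last point is the point reached by q y x after a
    steps.  Walks from different vertices may meet only when they follow the
    same edge in opposite directions, and then not within a steps of both. *)
Section DiscreteDrawing.
Local Open Scope nat_scope.
Variables (V : finType) (e : rel V).
Hypotheses (e_sym : symmetric e) (e_irr : irreflexive e).
Variables (a n : nat) (ctr : V -> lattice_pt) (q : V -> V -> nat -> lattice_pt).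
Hypothesis q_box : forall x y k, e x y -> k <= a.*2 ->
  0 < (q x y k).1 < n.+1 /\ 0 < (q x y k).2 < n.+1.
Hypothesis q_adj : forall x y k, e x y -> k < a.*2 ->
  q x y k = q x y k.+1 \/ ladj (q x y k) (q x y k.+1).
Hypothesis q_start : forall x y, e x y -> q x y 0 = ctr x.
Hypothesis q_meet : forall x y, e x y -> q x y a.*2 = q y x a.
Hypothesis q_apart : forall x y x' y' k k', e x y -> e x' y' -> x != x' -> (x', y') != (y, x) ->
  k <= a.*2 -> k' <= a.*2 -> q x y k != q x' y' k'.
Hypothesis q_apart_rev : forall x y k k', e x y -> k <= a -> k' <= a -> q x y k != q y x k'.

(** The branch set of x consists of the first thirds of all walks from x and,
    for edges oriented away from x, of the points visited before the walk
    meets the core of the other end.  Cutting at the first visit keeps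
    branch sets connected and disjoint, although a walk may enter and leave
    the core of its target several times. *)
Definition core (x : V) (u : lattice_pt) : bool :=
  [exists y, e x y && [exists k : 'I_a.+1, u == q x y k]].

Lemma core_walk x y k : e x y -> k <= a -> core x (q x y k).
Proof.
move=> xy ka; apply/existsP; exists y; rewrite xy /=.
by apply/existsP; exists (Ordinal (ka : k < a.+1)).
Qed.

Lemma coreP x u : core x u -> exists y k, [/\ e x y, k <= a & u = q x y k].
Proof. by case/existsP => y /andP[xy /existsP[k /eqP->]]; exists y, k; rewrite -ltnS. Qed.

Definition entered (x y : V) (k : nat) : bool := [exists j : 'I_k.+1, core y (q x y j)].

Definition extension (x : V) (u : lattice_pt) : bool :=
  [exists y, oriented e (x, y) &&
     [exists k : 'I_a.*2.+1, ~~ entered x y k && (u == q x y k)]].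

Lemma extension_walk x y k : oriented e (x, y) -> ~~ entered x y k -> k <= a.*2 ->
  extension x (q x y k).
Proof.
move=> xy nk ka; apply/existsP; exists y; rewrite xy /=.
by apply/existsP; exists (Ordinal (ka : k < a.*2.+1)); rewrite nk /=.
Qed.

Lemma extensionP x u : extension x u ->
  exists y k, [/\ oriented e (x, y), ~~ entered x y k, k <= a.*2 & u = q x y k].
Proof.
case/existsP => y /andP[xy /existsP[k /andP[nk /eqP->]]]; exists y, k.
by rewrite xy nk -ltnS.
Qed.

Lemma enteredW x y j k : j <= k -> core y (q x y j) -> entered x y k.
Proof. by move=> jk c; apply/existsP; exists (Ordinal (jk : j < k.+1)). Qed.

Lemma entered_mono x y j k : j <= k -> entered x y j -> entered x y k.
Proof. by move=> jk /existsP[i]; apply: enteredW; have := ltn_ord i; lia. Qed.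

Definition branch_set (x : V) (u : lattice_pt) : bool := core x u || extension x u.

Lemma core_disjoint x x' u : core x u -> core x' u -> x = x'.
Proof.
move=> /coreP[y [k [xy ka ->]]] /coreP[y' [k' [xy' ka' E]]]; apply/eqP.
have aa j : j <= a -> j <= a.*2 by rewrite -addnn; lia.
apply: contraTT isT => xx'; have [[E1 E2]|n'] := (x', y') =P (y, x).
  by move: E; rewrite E1 E2 => /eqP; rewrite (negPf (q_apart_rev xy ka ka')).
have /negP[] := q_apart xy xy' xx' (introN eqP n') (aa _ ka) (aa _ ka').
by rewrite E.
Qed.

Lemma core_extension_disjoint x x' u : core x u -> extension x' u -> x = x'.
Proof.
move=> cu /extensionP[y' [k' [or' ne' ka' E]]]; apply/eqP; apply: contraTT isT => xx'.
have [xy'|xy'] := eqVneq x y'.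
  by case/negP: ne'; apply: enteredW (leqnn _) _; rewrite -E -xy'.
move: cu => /coreP[y [k [xy ka Eq]]].
have ka2 : k <= a.*2 by rewrite -addnn; lia.
have nyx : (x', y') != (y, x) by rewrite xpair_eqE [y' == x]eq_sym (negPf xy') andbF.
have /negP[] := q_apart xy (proj1 (andP or')) xx' nyx ka2 ka'.
by rewrite -Eq E.
Qed.

Lemma extension_disjoint x x' u : extension x u -> extension x' u -> x = x'.
Proof.
move=> /extensionP[y [k [ori ne ka ->]]] /extensionP[y' [k' [or' ne' ka' E]]].
apply/eqP; apply: contraTT isT => xx'.
have nyx : (x', y') != (y, x) by apply: contraTneq or' => -[-> ->]; apply: oriented_asym.
have /negP[] := q_apart (proj1 (andP ori)) (proj1 (andP or')) xx' nyx ka ka'.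
by rewrite E.
Qed.

Lemma branch_set_disjoint x x' u : branch_set x u -> branch_set x' u -> x = x'.
Proof.
case/orP => [c|c] /orP[c'|c'].
- exact: core_disjoint c c'.
- exact: core_extension_disjoint c c'.
- by apply/esym; apply: core_extension_disjoint c' c.
- exact: extension_disjoint c c'.
Qed.

Definition branch_lab (u : lattice_pt) : option V := [pick x | branch_set x u].

Lemma branch_labP u x : branch_lab u = Some x <-> branch_set x u.
Proof.
rewrite /branch_lab; case: pickP => [x' x'u|no]; split=> //.
- by move=> [<-].
- by move=> xu; rewrite (branch_set_disjoint x'u xu).
- by rewrite no.
Qed.

Lemma branch_set_linked x y k : e x y -> k <= a.*2 -> (forall j, j <= k -> branch_set x (q x y j)) ->
  linked (fun u => branch_lab u == Some x) (ctr x) (q x y k).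
Proof.
move=> xy; elim: k => [|k IH] ka cl; first by rewrite q_start //; exact: Linked_refl.
have L := IH (ltnW ka) (fun j jk => cl j (leqW jk)).
have [<-//|adj] := q_adj xy ka; apply: Linked_step L _ _ adj.
  by apply/eqP/branch_labP/cl.
by apply/eqP/branch_labP/cl.
Qed.

(** The step that first enters the core of the target represents the edge. *)
Lemma discrete_lattice_model :
  lattice_model (@esrc V e) (@etgt V e) n.+1 branch_lab ctr.
Proof.
split.
- move=> u x /branch_labP/orP[/coreP[y [k [xy ka ->]]]|/extensionP[y [k [/andP[xy _] _ ka ->]]]].
    by apply: q_box => //; rewrite -addnn; lia.
  exact: q_box.
- move=> u x /branch_labP/orP[/coreP[y [k [xy ka ->]]]|/extensionP[y [k [ori ne ka ->]]]].
    apply: branch_set_linked => // [|j jk]; first by rewrite -addnn; lia.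
    by rewrite /branch_set core_walk // (leq_trans jk).
  apply: branch_set_linked => // [|j jk]; first by case/andP: ori.
  rewrite /branch_set extension_walk ?orbT ?(leq_trans jk) //.
  by apply: contra ne; apply: entered_mono.
- move=> [[x y] ori]; rewrite /esrc /etgt /=; have /andP[/= xy _] := ori.
  have yx : e y x by rewrite e_sym.
  have : entered x y a.*2 by apply: enteredW (leqnn _) _; rewrite q_meet // core_walk.
  have n0 : ~~ entered x y 0.
    apply/negP => /existsP[[[|//] i0]] /= cy.
    have := core_disjoint cy (core_walk xy (leq0n a)) => yx'.
    by rewrite yx' e_irr in xy.
  move=> en; have ex : exists k, entered x y k by exists a.*2.
  have [[|k] ek kmin] := ex_minnP ex; first by rewrite ek in n0.
  have ka : k < a.*2 by apply: kmin.
  have nk : ~~ entered x y k by apply/negP => /kmin; rewrite ltnn.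
  have ck : branch_set x (q x y k) by rewrite /branch_set extension_walk ?orbT // ltnW.
  have ck' : branch_set y (q x y k.+1).
    case/existsP: ek => -[j jk] /= cj; move: jk; rewrite ltnS leq_eqVlt => /orP[/eqP<-|jk].
      by rewrite /branch_set cj.
    by case/negP: nk; apply: enteredW cj.
  exists (q x y k), (q x y k.+1); split; try exact/branch_labP.
  have [E|//] := q_adj xy ka; rewrite E in ck.
  by have xy' := branch_set_disjoint ck ck'; rewrite xy' e_irr in xy.
Qed.
End DiscreteDrawing.

(** * Sampling a plane drawing *)

Section Sampling.
Local Open Scope ring_scope.
Variable R : realType.

(** A common bound for finitely many pairs of arcs. *)
Lemma finite_uniform (I : finType) (P : I -> R -> Prop) :
    (forall i d d', 0 < d' -> d' <= d -> P i d -> P i d') ->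
    (forall i, exists2 d, 0 < d & P i d) ->
  exists2 d, 0 < d & forall i, P i d.
Proof.
move=> Pmono Pex; suff [d d0 dP] : exists2 d, 0 < d & forall i, i \in enum I -> P i d.
  by exists d => // i; apply: dP; rewrite mem_enum.
elim: (enum I) => [|i s [d d0 dP]]; first by exists 1.
have [d' d'0 d'P] := Pex i; have m0 : 0 < Num.min d d' by rewrite lt_min d0.
exists (Num.min d d') => // j; rewrite inE => /orP[/eqP->|js].
  by apply: Pmono d'P; rewrite // ge_min lexx orbT.
by apply: Pmono (dP j js); rewrite // ge_min lexx.
Qed.

Lemma truncn_close (x y : R) : 0 <= x -> 0 <= y -> `|x - y| < 1 ->
  (Num.trunc x <= (Num.trunc y).+1)%N.
Proof.
move=> x0 y0; rewrite ltr_norml => /andP[_ xy].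
have /andP[tx _] := truncn_itv x0; have /andP[_ ty] := truncn_itv y0.
rewrite -ltnS -(ltr_nat R); apply: le_lt_trans tx _; move: ty.
by rewrite -!natr1; lra.
Qed.

Lemma truncn_far (x y : R) k : 0 <= x -> 0 <= y ->
  (Num.trunc x <= Num.trunc y + k)%N -> x - y < k.+1%:R.
Proof.
move=> x0 y0; rewrite -(ler_nat R) natrD => txy.
have /andP[_ tx] := truncn_itv x0; have /andP[ty _] := truncn_itv y0.
by move: tx; rewrite -!natr1; lra.
Qed.

(** The square of side 1/n that contains p, in coordinates shifted by M + 1
    so that they are positive for all points with coordinates bounded by M. *)
Definition cell (n : nat) (M : R) (p : R * R) : lattice_pt :=
  (Num.trunc (n%:R * (p.1 + M + 1)), Num.trunc (n%:R * (p.2 + M + 1))).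

Section Cell.
Variables (n : nat) (M : R).
Hypothesis n0 : (0 < n)%N.

Let scaled_ge (u : R) : `|u| <= M -> n%:R <= n%:R * (u + M + 1).
Proof.
rewrite ler_norml => /andP[u1 u2]; rewrite ler_peMr ?ler0n //; lra.
Qed.

Lemma trunc_box (u : R) : `|u| <= M ->
  (0 < Num.trunc (n%:R * (u + M + 1)) < (Num.trunc (n%:R * (M + M + 1))).+1)%N.
Proof.
move=> uM; rewrite truncn_gt0 (le_trans _ (scaled_ge uM)) ?ler1n //= ltnS.
apply: le_truncn; rewrite ler_wpM2l ?ler0n //.
by move: uM; rewrite ler_norml => /andP[]; lra.
Qed.

Let scaled_ge0 (u : R) : `|u| <= M -> 0 <= n%:R * (u + M + 1).
Proof. by move=> /scaled_ge; apply: le_trans; rewrite ler0n. Qed.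

Lemma trunc_near (u v : R) : `|u| <= M -> `|v| <= M -> `|u - v| < n%:R^-1 ->
  (Num.trunc (n%:R * (u + M + 1)) <= (Num.trunc (n%:R * (v + M + 1))).+1)%N.
Proof.
move=> uM vM uv; apply: truncn_close; rewrite ?scaled_ge0 //.
rewrite -mulrBr (_ : _ - _ = u - v); last by lra.
by rewrite normrM ger0_norm ?ler0n // mulrC -ltr_pdivlMr ?ltr0n // div1r.
Qed.

Lemma trunc_apart (u v : R) : `|u| <= M -> `|v| <= M ->
  (Num.trunc (n%:R * (u + M + 1)) <= Num.trunc (n%:R * (v + M + 1)) + 2)%N ->
  (Num.trunc (n%:R * (v + M + 1)) <= Num.trunc (n%:R * (u + M + 1)) + 2)%N ->
  `|u - v| < 3 / n%:R.
Proof.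
move=> uM vM uv vu; rewrite ltr_pdivlMr ?ltr0n // mulrC.
rewrite -[X in X * _](@ger0_norm _ n%:R) ?ler0n // -normrM.
have := truncn_far (scaled_ge0 uM) (scaled_ge0 vM) uv.
have := truncn_far (scaled_ge0 vM) (scaled_ge0 uM) vu.
rewrite ltr_norml; lra.
Qed.
End Cell.

Lemma half_bounds (k m : nat) : (k <= (2 * m).*2)%N ->
  [/\ k./2 <= 2 * m, k./2 <= 3 * m & uphalf k <= 3 * m]%N.
Proof. by move=> km; split; lia. Qed.

Lemma half_lt (k m : nat) : (k < (2 * m).*2)%N -> (k./2.+1 <= 3 * m)%N.
Proof. lia. Qed.

Lemma half_small (k m : nat) : (k <= 2 * m)%N -> (k./2 <= 1 * m)%N /\ (k <= (2 * m).*2)%N.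
Proof. by move=> km; split; lia. Qed.

(** Cells of nearby points that share a coordinate are equal or adjacent. *)
Lemma near_step (c c' k : nat) : (c <= c'.+1)%N -> (c' <= c.+1)%N ->
  ((c, k) = (c', k) \/ ladj (c, k) (c', k)) /\ ((k, c) = (k, c') \/ ladj (k, c) (k, c')).
Proof.
move=> cc' c'c; have [->|nc] := eqVneq c c'; first by split; left.
have cE : (c' == c.+1) || (c == c'.+1) by move: nc; lia.
by split; right; apply/existsP; [exists false | exists true];
  rewrite /step /= !xpair_eqE eqxx ?andbT.
Qed.

Section Drawing.
Variables (V : finType) (e : rel V).
Hypotheses (e_sym : symmetric e) (e_irr : irreflexive e).
Variables (pos : V -> R * R) (arc : V -> V -> R -> R * R).
Hypothesis drawing : plane_drawing e pos arc.

(** Truncated before their ends, arcs from different vertices are disjoint; the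
    two parametrizations of the same edge are so when the truncations do
    not overlap. *)
Lemma initial_arcs_disjoint x y x' y' (a b s t : R) : e x y -> e x' y' -> x <> x' ->
    a < 1 -> b < 1 -> (x', y') <> (y, x) \/ a + b < 1 ->
    s \in `[0, a] -> t \in `[0, b] -> arc x y s <> arc x' y' t.
Proof.
move=> xy xy' nx a1 b1 ab; rewrite !in_itv /= => /andP[s0 sa] /andP[t0 tb].
have inner (u c : R) : 0 <= u -> u <= c -> c < 1 -> u <> 0 -> u \in `]0, 1[.
  move=> u0 uc c1 un; rewrite in_itv /= lt_neqAle eq_sym u0 andbT (le_lt_trans uc c1) andbT.
  exact/eqP.
have [s_0|/eqP sn0] := eqVneq s 0.
  rewrite s_0 (arc_start drawing xy); have [t_0|/eqP tn0] := eqVneq t 0.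
    by rewrite t_0 (arc_start drawing xy') => /(pos_inj drawing).
  apply/nesym; apply: (arc_avoids_pos drawing) xy' (inner _ _ t0 tb b1 tn0).
have [t_0|/eqP tn0] := eqVneq t 0.
  rewrite t_0 (arc_start drawing xy').
  exact: (arc_avoids_pos drawing) xy (inner _ _ s0 sa a1 sn0).
have [[E1 E2]|n'] := (x', y') =P (y, x); last first.
  apply: (arc_disjoint drawing) xy xy' _ n' (inner _ _ s0 sa a1 sn0) (inner _ _ t0 tb b1 tn0).
  by move=> [/esym].
case: ab => [[]|ab]; first by rewrite E1 E2.
have t01 : t \in `[0, 1] by rewrite in_itv /= t0 (le_trans tb (ltW b1)).
rewrite E1 E2 (arc_reverse drawing xy t01) => st.
have : s = 1 - t; last by lra.
by apply: (arc_inj drawing xy) st; rewrite in_itv /=; apply/andP; split; lra.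
Qed.

(** Sample each arc at the parameters j / 3m.  Consecutive cells may be
    diagonal neighbours, so the walk moves one coordinate at a time: its
    point of index k has the first coordinate of the sample of index
    uphalf k and the second coordinate of the sample of index k./2.  Each
    coordinate is within one unit of the cell of the latter sample, so
    if two walks meet then the samples are at distance less than 6/n;
    the grid is chosen finer than the distance d between disjoint
    truncated arcs, so that 6 < n d. *)
Theorem drawing_lattice_model : exists n lab ctr,
  lattice_model (@esrc V e) (@etgt V e) n.+1 lab ctr.
Proof.
pose g x y := arc x y \o @clamp R.
have gc x y : e x y -> continuous (g x y).
  by move=> xy; apply: continuous_clamp; apply: arc_continuous drawing _ _ xy.
have gE x y t : t \in `[0, 1] -> g x y t = arc x y t by move=> t01; rewrite /g /= clamp_id.
(* A common bound on the coordinates, inverted to fit a statement about small numbers. *)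
have [M0 _ M0P] : exists2 M : R, 0 < M & forall xy : V * V, e xy.1 xy.2 ->
    forall t, t \in `[0, 1] -> `|(g xy.1 xy.2 t).1| <= M^-1 /\ `|(g xy.1 xy.2 t).2| <= M^-1.
  apply: finite_uniform => [i d d' d'0 dd' dP xy t t01|[x y] /=].
    have dd : d^-1 <= d'^-1 by rewrite lef_pV2 ?posrE // (lt_le_trans d'0).
    by have [g1 g2] := dP xy t t01; rewrite !(le_trans _ dd).
  have [xy|nxy] := boolP (e x y); last by exists 1.
  have [B BP] := curve_bounded (gc _ _ xy).
  have B0 : 0 < `|B| + 1 by rewrite ltr_pwDr.
  exists (`|B| + 1)^-1; first by rewrite invr_gt0.
  move=> _ t /BP[g1 g2]; rewrite invrK.
  have BB : B <= `|B| + 1 by rewrite ler_wpDr // ler_norm.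
  by rewrite !(le_trans _ BB).
pose M := M0^-1.
have gM x y t : e x y -> t \in `[0, 1] -> `|(g x y t).1| <= M /\ `|(g x y t).2| <= M.
  by move=> xy; apply: (M0P (x, y)).
have lt23 : (2 / 3 : R) < 1 by lra.
have lt13 : (1 / 3 : R) < 1 by lra.
have [d1 d10 d1P] : exists2 d : R, 0 < d & forall i : (V * V) * (V * V),
    e i.1.1 i.1.2 -> e i.2.1 i.2.2 -> i.1.1 <> i.2.1 -> i.2 <> (i.1.2, i.1.1) ->
    forall s t, s \in `[0, 2 / 3] -> t \in `[0, 2 / 3] ->
      d <= pdist (g i.1.1 i.1.2 s) (g i.2.1 i.2.2 t).
  apply: finite_uniform => [i d d' _ dd' dP xy xy' nx ny s t s1 t1|[[x y] [x' y']] /=].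
    by apply: le_trans dd' _; apply: dP.
  have [/and4P[xy xy' nx ny]|nP] :=
      boolP [&& e x y, e x' y', x != x' & (x', y') != (y, x)]; last first.
    exists 1 => // xy xy' /eqP nx /eqP ny; case/negP: nP; exact/and4P.
  have [s t si ti|d d0 dP] := @curves_apart _ (g x y) (g x' y') (2 / 3) (2 / 3) (gc _ _ xy) (gc _ _ xy') _.
    rewrite !gE; last 2 first.
    - by move: ti; rewrite !in_itv /= => /andP[-> /=]; lra.
    - by move: si; rewrite !in_itv /= => /andP[-> /=]; lra.
    by apply: (initial_arcs_disjoint xy xy' (elimN eqP nx) lt23 lt23 (or_introl (elimN eqP ny)) si ti).
  by exists d.
have [d2 d20 d2P] : exists2 d : R, 0 < d & forall i : V * V,
    e i.1 i.2 -> forall s t, s \in `[0, 1 / 3] -> t \in `[0, 1 / 3] ->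
      d <= pdist (g i.1 i.2 s) (g i.2 i.1 t).
  apply: finite_uniform => [i d d' _ dd' dP xy s t s1 t1|[x y] /=].
    by apply: le_trans dd' _; apply: dP.
  have [xy|nxy] := boolP (e x y); last by exists 1.
  have yx : e y x by rewrite e_sym.
  have [s t si ti|d d0 dP] := @curves_apart _ (g x y) (g y x) (1 / 3) (1 / 3) (gc _ _ xy) (gc _ _ yx) _.
    rewrite !gE; last 2 first.
    - by move: ti; rewrite !in_itv /= => /andP[-> /=]; lra.
    - by move: si; rewrite !in_itv /= => /andP[-> /=]; lra.
    apply: (initial_arcs_disjoint xy yx _ lt13 lt13 (or_intror _) si ti); last by lra.
    by move=> xy'; rewrite xy' e_irr in xy.
  by exists d.
pose d := Num.min d1 d2.
have d0 : 0 < d by rewrite lt_min d10.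
pose n := (Num.trunc (6 / d)).+1.
have nd : 6 < n%:R * d by rewrite -ltr_pdivrMr //; apply: truncnS_gt.
have n0 : 0 < (n%:R : R) by rewrite ltr0n.
have [r r0 rP] : exists2 r : R, 0 < r & forall i : V * V, e i.1 i.2 ->
    forall s t, s \in `[0, 1] -> t \in `[0, 1] -> `|s - t| < r ->
      pdist (g i.1 i.2 s) (g i.1 i.2 t) < n%:R^-1.
  apply: finite_uniform => [i c c' _ cc' cP xy s t s1 t1 st|[x y] /=].
    by apply: cP => //; apply: lt_le_trans st cc'.
  have [xy|nxy] := boolP (e x y); last by exists 1.
  have n0' : 0 < (n%:R : R)^-1 by rewrite invr_gt0.
  have [c c0 cP] := curve_uniform (gc _ _ xy) n0'.
  by exists c.
pose m := (Num.trunc r^-1).+1.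
have m0 : 0 < (m%:R : R) by rewrite ltr0n.
have mr : m%:R^-1 < r.
  by rewrite -[r]invrK ltf_pV2 ?posrE ?invr_gt0 //; apply: truncnS_gt.
have m_gt0 : (0 < m)%N by [].
have n_gt0 : (0 < n)%N by [].
clearbody n m M.
(* The sampled parameters; first thirds end at index m, second thirds at 2m. *)
pose tm (j : nat) : R := j%:R / (3 * m%:R).
have tm0 j : 0 <= tm j by rewrite divr_ge0 ?mulr_ge0.
have tmS j : `|tm j.+1 - tm j| < r.
  rewrite /tm -mulrBl -natrB // subSnn normrM normr1 mul1r ger0_norm; last first.
    by rewrite invr_ge0 mulr_ge0 // ltW.
  apply: le_lt_trans mr; rewrite lef_pV2 ?posrE ?mulr_gt0 //; lra.
have tm_le j k (c : R) : (j <= k * m)%N -> k%:R / 3 = c -> tm j \in `[0, c].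
  move=> jk <-; rewrite in_itv /= tm0 /= /tm ler_pdivrMr ?mulr_gt0 // mulrA divfK //.
  by rewrite -natrM ler_nat.
have tm1 j : (j <= 3 * m)%N -> tm j \in `[0, 1].
  by move=> /tm_le; apply; rewrite divff.
pose q x y k := ((cell n M (g x y (tm (uphalf k)))).1, (cell n M (g x y (tm k./2))).2).
have qE x y k : e x y -> (k <= (2 * m).*2)%N ->
  [/\ (q x y k).1 <= ((cell n M (g x y (tm k./2))).1).+1,
      ((cell n M (g x y (tm k./2))).1) <= (q x y k).1.+1 &
      (q x y k).2 = (cell n M (g x y (tm k./2))).2]%N.
  move=> xy km; have [_ j1 j2] := half_bounds km.
  have [bx1 by1] := gM _ _ _ xy (tm1 _ j1); have [bx2 by2] := gM _ _ _ xy (tm1 _ j2).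
  have close : `|(g x y (tm (uphalf k))).1 - (g x y (tm k./2)).1| < n%:R^-1.
    apply: le_lt_trans (rP (x, y) xy (tm (uphalf k)) (tm k./2) (tm1 _ j2) (tm1 _ j1) _).
      by rewrite /pdist ler_wpDr.
    by rewrite uphalf_half; case: (odd k); rewrite ?add0n ?add1n ?tmS // subrr normr0.
  split=> //; first by apply: trunc_near.
  by apply: trunc_near => //; rewrite distrC.
have clash x y x' y' k k' : e x y -> e x' y' ->
    (k <= (2 * m).*2)%N -> (k' <= (2 * m).*2)%N -> q x y k = q x' y' k' ->
    pdist (g x y (tm k./2)) (g x' y' (tm k'./2)) < d.
  move=> xy xy' km km' E; have [u1 u2 u3] := qE _ _ _ xy km.
  have [v1 v2 v3] := qE _ _ _ xy' km'.
  have [_ j1 _] := half_bounds km; have [_ j2 _] := half_bounds km'.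
  have [bx1 by1] := gM _ _ _ xy (tm1 _ j1); have [bx2 by2] := gM _ _ _ xy' (tm1 _ j2).
  rewrite -E in v1 v2 v3; rewrite u3 in v3.
  have c1 := @trunc_apart n M n_gt0 _ _ bx1 bx2 _ _.
  have c2 := @trunc_apart n M n_gt0 _ _ by1 by2 _ _.
  have nd' : 3 / n%:R + 3 / n%:R < d.
    by rewrite -mulrDl ltr_pdivrMr // mulrC; apply: le_lt_trans nd; lra.
  apply: lt_trans nd'; apply: ltrD; [apply: c1 | apply: c2].
  - by apply: leq_trans u2 _; rewrite addn2 ltnS; exact: v1.
  - by apply: leq_trans v2 _; rewrite addn2 ltnS; exact: u1.
  - by rewrite [X in (X <= _)%N]v3 leq_addr.
  - by rewrite -[X in (X <= _)%N]v3 leq_addr.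
exists (Num.trunc (n%:R * (M + M + 1))), (branch_lab e (2 * m) q), (fun x => cell n M (pos x)).
apply: discrete_lattice_model => //.
- move=> x y k xy ka; rewrite /q /cell /=.
  have [_ j1 j2] := half_bounds ka.
  have [_ by1] := gM _ _ _ xy (tm1 _ j1); have [bx2 _] := gM _ _ _ xy (tm1 _ j2).
  by split; apply: trunc_box.
- move=> x y k xy ka.
  have [_ j1 _] := half_bounds (ltnW ka); have j2 := half_lt ka.
  have [bx1 by1] := gM _ _ _ xy (tm1 _ j1); have [bx2 by2] := gM _ _ _ xy (tm1 _ j2).
  have close := rP (x, y) xy _ _ (tm1 _ j2) (tm1 _ j1) (tmS k./2).
  have close1 : `|(g x y (tm k./2.+1)).1 - (g x y (tm k./2)).1| < n%:R^-1.
    by apply: le_lt_trans close; rewrite /pdist ler_wpDr.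
  have close2 : `|(g x y (tm k./2.+1)).2 - (g x y (tm k./2)).2| < n%:R^-1.
    by apply: le_lt_trans close; rewrite /pdist ler_wpDl.
  rewrite /q [k.+1./2]/= [uphalf k.+1]/= uphalf_half; case: (odd k); rewrite ?add0n ?add1n /cell /=.
    apply: (proj2 (near_step _ _ _)); last exact: trunc_near.
    by apply: trunc_near => //; rewrite distrC.
  apply: (proj1 (near_step _ _ _)); last exact: trunc_near.
  by apply: trunc_near => //; rewrite distrC.
- by move=> x y xy; rewrite /q /= /tm mul0r gE ?bound_itvE // (arc_start drawing xy).
- move=> x y xy; rewrite /q uphalf_double doubleK mul2n uphalf_double doubleK.
  have tm2 : tm m.*2 = 1 - tm m.
    rewrite /tm -mul2n natrM; field; exact: lt0r_neq0.
  have m01 : tm m \in `[0, 1] by apply: tm1; rewrite leq_pmull.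
  have m02 : tm m.*2 \in `[0, 1] by apply: tm1; rewrite -mul2n leq_mul2r orbT.
  by rewrite !gE // (arc_reverse drawing xy) // tm2.
- move=> x y x' y' k k' xy xy' /eqP nx /eqP ny ka ka'; apply/eqP => E.
  have := clash _ _ _ _ _ _ xy xy' ka ka' E; rewrite ltNge ge_min.
  have -> // : d1 <= pdist (g x y (tm k./2)) (g x' y' (tm k'./2)).
  have [j1 _ _] := half_bounds ka; have [j2 _ _] := half_bounds ka'.
  by apply: (d1P ((x, y), (x', y'))) => //=; apply: (tm_le _ 2%N).
- move=> x y k k' xy ka ka'; apply/eqP => E.
  have yx : e y x by rewrite e_sym.
  have [j1 k1] := half_small ka; have [j2 k2] := half_small ka'.
  have := clash _ _ _ _ _ _ xy yx k1 k2 E; rewrite ltNge ge_min.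
  have -> : d2 <= pdist (g x y (tm k./2)) (g y x (tm k'./2)).
    by apply: (d2P (x, y)) => //=; apply: (tm_le _ 1%N).
  by rewrite orbT.
Qed.
End Drawing.
End Sampling.

(** * Edge bound for plane graphs *)

Section EdgeCount.
Local Open Scope nat_scope.
Variables (V : finType) (e : rel V).
Hypotheses (e_sym : symmetric e) (e_irr : irreflexive e).

Lemma sum_degree : \sum_(x : V) degree e x = 2 * #|{: edge_type e}|.
Proof.
rewrite card_sig mul2n -addnn.
have -> : \sum_(x : V) degree e x = #|[pred p : V * V | e p.1 p.2]|.
  rewrite -sum1_card -(pair_big_dep xpredT (fun x y => e x y) (fun _ _ => 1)) /=.
  by apply: eq_bigr => x _; rewrite sum1_card.
rewrite -(cardID (oriented e)); congr (_ + _).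
  by apply: eq_card => p; rewrite !inE /oriented; case: (e _ _).
have swap_inj : injective (fun p : V * V => (p.2, p.1)).
  by move=> [x y] [x' y'] [-> ->].
rewrite -[RHS](fintype.card_image swap_inj); apply: eq_card => -[x y].
apply/idP/fintype.imageP => [|[[x' y'] o [-> ->]]].
  rewrite !inE => /andP[no xy]; exists (y, x) => //.
  rewrite unfold_in /oriented /= e_sym (xy : e x y) /=.
  by have := oriented_total e_irr (xy : e x y); rewrite (negPf no : oriented e (x, y) = false).
rewrite !inE (oriented_asym o) /=; case/andP: o => /= xy _.
by rewrite e_sym.
Qed.

Variables (n g : nat) (lab : lattice_pt -> option V) (ctr : V -> lattice_pt).
Hypothesis model : lattice_model (@esrc V e) (@etgt V e) n.+1 lab ctr.
Hypothesis e_girth : forall c, ucycle e c -> 2 < size c -> g <= size c.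

Lemma lattice_edge_bound : 0 < #|V| ->
  g * #|{: edge_type e}|.+1 <= g * #|V| + 2 * #|{: edge_type e}|.
Proof.
move=> V0; have ll := edge_loopless e_irr; have sp := @edge_simple V e.
apply: (edge_bound (cycle_cut ll sp model) (face_cycle ll sp model)) => // z zc [f zf].
have [c [/andP[cc uc] sc cz]] := cycle_contains_cycle ll sp zc zf.
apply: leq_trans cz; apply: e_girth sc; apply/andP; split=> //.
apply: sub_cycle cc => x y /existsP[[[x' y'] o] /andP[_]].
have /andP[/= xy _] := o.
by rewrite /joins /esrc /etgt /= => /orP[] /andP[/eqP <- /eqP <-]; rewrite // e_sym.
Qed.
End EdgeCount.

Section PlanarSubgraphs.
Local Open Scope nat_scope.
Variables (R : realType) (T : finType) (e : rel T).
Hypotheses (e_sym : symmetric e) (e_irr : irreflexive e).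
Hypothesis e_planar : planar R e.
Hypothesis e_girth : forall c, ucycle e c -> 2 < size c -> 8 <= size c.

Lemma planar_sub (X : {set T}) : planar R (relpre (val : {x | x \in X} -> T) e).
Proof.
case: e_planar => pos [arc [pi ac ai as_ ae ar ap ad]].
exists (pos \o val), (fun x y => arc (val x) (val y)); split.
- by move=> x y /= /pi/val_inj.
- by move=> x y; apply: ac.
- by move=> x y; apply: ai.
- by move=> x y; apply: as_.
- by move=> x y; apply: ae.
- by move=> x y t; apply: ar.
- by move=> x y z t; apply: ap.
- move=> x y x' y' t t' xy xy' n1 n2; apply: ad => //.
    by move=> [/val_inj E1 /val_inj E2]; apply: n1; rewrite E1 E2.
  by move=> [/val_inj E1 /val_inj E2]; apply: n2; rewrite E1 E2.
Qed.

Lemma planar_sparse (X : {set T}) : X != finset.set0 ->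
  3 * (\sum_(x in X) inner_degree e X x) < 8 * #|X|.
Proof.
move=> X0; pose V := {x | x \in X}; pose eX : rel V := relpre val e.
have [pos [arc drawing]] := planar_sub X.
have eX_sym : symmetric eX by move=> x y; apply: e_sym.
have eX_irr : irreflexive eX by move=> x; apply: e_irr.
have [n [lab [ctr model]]] := drawing_lattice_model eX_sym eX_irr drawing.
have girthX c : ucycle eX c -> 2 < size c -> 8 <= size c.
  move=> /andP[cc uc] sc; rewrite -(size_map val) e_girth ?size_map //.
  by apply/andP; split; [rewrite cycle_map | rewrite map_inj_uniq //; apply: val_inj].
have cV : #|{: V}| = #|X| by rewrite card_sig; apply: eq_card.
have V0 : 0 < #|{: V}| by rewrite cV card_gt0.
have := lattice_edge_bound eX_sym eX_irr model girthX V0.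
rewrite big_sub (eq_bigr (degree eX)) => [|x _].
  rewrite (sum_degree eX_sym eX_irr) cV; move: #|{: edge_type eX}| #|X| => E k; lia.
rewrite /inner_degree /degree -!sum1_card.
rewrite (eq_bigl (fun y => (y \in X) && e (val x) y)) // big_mkcondr big_sub.
by rewrite [RHS]big_mkcond.
Qed.
End PlanarSubgraphs.

(** * Packing colourings of the whole graph *)

Section Translation.
Local Open Scope nat_scope.
Variables (R : realType) (T : finType) (e : rel T).

Lemma girth_cycle (g : nat) : (((g%:R : R)%R)%:E <= girth R e)%E ->
  forall c, ucycle e c -> 2 < size c -> g <= size c.
Proof.
move=> ge c uc sc; rewrite -(ler_nat R) -lee_fin; apply: le_trans ge _.
by apply: ereal_inf_lbound; exists c.
Qed.

Lemma gdist_ge (d : nat) x y :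
    (forall p, path e x p -> last x p = y -> d <= size p) ->
  (((d%:R : R)%R)%:E <= gdist R e x y)%E.
Proof.
move=> dp; apply: le_ereal_inf_tmp => _ [p [ep lp] <-].
by rewrite lee_fin ler_nat dp.
Qed.

(** Near colours become 0 and 1, far colours 2 and 3, as in the sequence
    (1, 1, 2, 2). *)
Definition colour_index (k : bool * bool) : 'I_4 := inord (k.1.*2 + k.2).

Lemma colour_indexE k : colour_index k = k.1.*2 + k.2 :> nat.
Proof. by rewrite inordK //; case: k => -[] []. Qed.

Lemma colour_index_inj : injective colour_index.
Proof.
move=> k k' /(congr1 val); rewrite /= !colour_indexE.
by case: k => -[] []; case: k' => -[] [].
Qed.

Lemma partial_packing_colorable c : symmetric e ->
  partial_packing e [set: T]%SET c -> packing_colorable R e [:: 1; 1; 2; 2].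
Proof.
move=> e_sym [c1 c2]; exists (fun x => colour_index (c x)) => x y /eqP xy /colour_index_inj cxy.
have -> : nth 0 [:: 1; 1; 2; 2] (colour_index (c x)) = (c x).1.+1.
  by rewrite colour_indexE; case: (c x) => -[] [].
have nadj u v : c u = c v -> e u v -> False.
  by move=> uv /c1; rewrite !inE uv eqxx => /(_ isT isT).
apply: gdist_ge => -[|u [|v p]] //=.
- by move=> _ E; rewrite E eqxx in xy.
- by rewrite andbT => xu E; case: (nadj x y cxy); rewrite -E.
case far: (c x).1 => //; case: p => //= /and3P[xu uv _] E; rewrite E in uv.
have := c2 x y u; rewrite !inE e_sym xu uv xy far cxy eqxx.
by move=> /(_ isT isT isT isT isT isT isT).
Qed.
End Translation.

Theorem corollary1p4 (R : realType) (T : finType) (e : rel T)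
    (e_sym : symmetric e) (e_irr : irreflexive e)
    (e_subcubic : subcubic e) (e_planar : planar R e)
    (e_girth : ((8%:R : R)%:E <= girth R e)%E) :
  packing_colorable R e [:: 1; 1; 2; 2]%N.
Proof.
have short := girth_cycle e_girth.
have ne x y : e x y -> x != y by apply: adj_neq e_irr _ _.
have [|x y z xy yz zx|x y z t xy yz zt tx xz yt|X X0|c cT] :=
    @sparse_packing T e e_sym e_irr _ _ _ _ [set: T]%SET.
- by move=> x; apply: leq_trans e_subcubic; apply: (leq_bigmax (F := degree e)).
- have /short/(_ isT) // : ucycle e [:: x; y; z].
  by rewrite /ucycle /= xy yz zx !inE negb_or ne // [x == z]eq_sym !ne.
- have /short/(_ isT) // : ucycle e [:: x; y; z; t].
  by rewrite /ucycle /= xy yz zt tx !inE !negb_or xz yt [x == t]eq_sym !ne.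
- exact: planar_sparse e_planar short _ X0.
exact: partial_packing_colorable e_sym cT.
Qed.
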